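(* Let $\mathbb A$ be the 3D cyclic algebra, let $k\in\mathbb A=\mathbb R^3$ be a constant vector, and let $\varphi:\mathbb R^3\to\mathbb A$ be the affine map $\varphi(q)=Aq+k$, where $$A=\begin{pmatrix}-1&-1&0\\ 1&0&-1\\ 0&1&1\end{pmatrix}.$$ Let $\mathcal U\subset\mathbb R^3$ be open and let $\mathbf F=F^1e+F^2e_2+F^3e_3:\mathcal U\to\mathbb A$ be a $\varphi\mathbb A$-differentiable vector field, satisfying the Cauchy-Riemann equations $$\begin{aligned} F^1_x-F^1_y-F^2_x+F^3_y&=0,\\ -F^1_x+F^2_y+F^3_x-F^3_y&=0,\\ -F^1_z-F^2_x+F^3_x+F^3_z&=0,\\ F^1_x+F^1_z-F^2_z-F^3_x&=0 \end{aligned}$$ on $\mathcal U$. Then the components of $\mathbf F$ are harmonic, i.e. $F^i_{xx}+F^i_{yy}+F^i_{zz}=0$ on $\mathcal U$ for $i=1,2,3$; equivalently $\Delta\mathbf F=\mathbf 0$.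
   Context: The 3D cyclic algebra $\mathbb A$ is $\mathbb R^3$ with canonical basis $e=e_1,e_2,e_3$ and the bilinear, commutative, associative product $\ast$ with identity $e$ determined by $e_2\ast e_2=e_3$, $e_2\ast e_3=e$, $e_3\ast e_3=e_2$. Coordinates on $\mathbb R^3$ are $(x,y,z)$; subscripts $x,y,z$ denote partial derivatives. $\varphi\mathbb A$-differentiability: given $\varphi:\mathcal U\subset\mathbb R^3\to\mathbb A$ differentiable in the usual sense, a map $\mathbf F:\mathcal U\to\mathbb A$ is $\varphi\mathbb A$-differentiable if $\mathbf F$ is differentiable in the usual sense and there exists a map $\mathbf F'_\varphi:\mathcal U\to\mathbb A$ such that $d\mathbf F_q(v)=\mathbf F'_\varphi(q)\ast d\varphi_q(v)$ for all $q\in\mathcal U$ and $v\in\mathbb R^3$. *)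

(* Defs.v *)
From HB Require Import structures.
From mathcomp Require Import all_boot all_order all_algebra.
From mathcomp Require Import all_classical all_reals all_analysis.

Set Implicit Arguments.
Unset Strict Implicit.
Unset Printing Implicit Defensive.

Import Order.TTheory GRing.Theory Num.Theory.
Import numFieldNormedType.Exports.

Local Open Scope classical_set_scope.
Local Open Scope ring_scope.

(* Indices are shifted by one: the mathematical e_1, e_2, e_3 (and x, y, z)
   correspond to the indices 0, 1, 2 : 'I_3, where 'I_3 carries its ring
   structure Z/3Z. *)

Section CyclicAlgebra.
Variable R : realType.
Implicit Types a b c : 'cV[R]_3.

Definition basis3 (i : 'I_3) : 'cV[R]_3 := delta_mx i 0.

(* With shifted indices the multiplication table reads e_i * e_j = e_(i + j),
   the sum being taken in Z/3Z; see [cyc_mul_table]. *)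
Definition cyc_mul a b : 'cV[R]_3 :=
  \sum_(i < 3) \sum_(j < 3) (a i 0 * b j 0) *: basis3 (i + j).

Lemma cyc_mulDl a b c : cyc_mul (a + b) c = cyc_mul a c + cyc_mul b c.
Proof.
rewrite /cyc_mul -big_split; apply: eq_bigr => i _ /=.
rewrite -big_split; apply: eq_bigr => j _ /=.
by rewrite mxE mulrDl scalerDl.
Qed.

Lemma cyc_mulZl (t : R) a b : cyc_mul (t *: a) b = t *: cyc_mul a b.
Proof.
rewrite /cyc_mul scaler_sumr; apply: eq_bigr => i _.
rewrite scaler_sumr; apply: eq_bigr => j _.
by rewrite mxE scalerA mulrA.
Qed.

Lemma cyc_mulC a b : cyc_mul a b = cyc_mul b a.
Proof.
rewrite /cyc_mul exchange_big; apply: eq_bigr => i _; apply: eq_bigr => j _.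
by rewrite mulrC addrC.
Qed.

Lemma cyc_mulDr a b c : cyc_mul a (b + c) = cyc_mul a b + cyc_mul a c.
Proof. by rewrite cyc_mulC cyc_mulDl !(cyc_mulC a). Qed.

Lemma cyc_mulZr (t : R) a b : cyc_mul a (t *: b) = t *: cyc_mul a b.
Proof. by rewrite cyc_mulC cyc_mulZl cyc_mulC. Qed.

Lemma cyc_mul_basis (i j : 'I_3) :
  cyc_mul (basis3 i) (basis3 j) = basis3 (i + j).
Proof.
rewrite /cyc_mul (bigD1 i) //= (bigD1 j) //= !mxE !eqxx mul1r scale1r.
rewrite big1 ?addr0; last first.
  by move=> j' /negPf nj; rewrite !mxE nj /= mulr0 scale0r.
rewrite big1 ?addr0 // => i' /negPf ni; rewrite big1 // => j' _.
by rewrite !mxE ni /= mul0r scale0r.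
Qed.

Lemma cyc_mul_table :
  [/\ forall a, cyc_mul (basis3 0) a = a,
      cyc_mul (basis3 1) (basis3 1) = basis3 2,
      cyc_mul (basis3 1) (basis3 2) = basis3 0 &
      cyc_mul (basis3 2) (basis3 2) = basis3 1].
Proof.
split; last 3 first.
- by rewrite cyc_mul_basis; congr basis3; apply: val_inj.
- by rewrite cyc_mul_basis; congr basis3; apply: val_inj.
- by rewrite cyc_mul_basis; congr basis3; apply: val_inj.
move=> a; rewrite /cyc_mul (bigD1 0) //= [X in _ + X]big1 ?addr0; last first.
  by move=> i /negPf ni; rewrite big1 // => j _; rewrite mxE ni mul0r scale0r.
apply/matrixP => k l; rewrite (ord1 l) summxE (bigD1 k) //= big1 ?addr0.
  by rewrite !mxE add0r !eqxx mul1r mulr1.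
by move=> j nj; rewrite !mxE add0r (eq_sym k) (negPf nj) mulr0.
Qed.

Lemma cyc_mulE a b (k : 'I_3) :
  cyc_mul a b k 0 = \sum_(i < 3) a i 0 * b (k - i) 0.
Proof.
rewrite summxE; apply: eq_bigr => i _; rewrite summxE (bigD1 (k - i)) //=.
rewrite !mxE [i + _]addrC subrK !eqxx mulr1 big1 ?addr0 // => j nj.
by rewrite !mxE [i + j]addrC -subr_eq [k - i == _]eq_sym (negPf nj) mulr0.
Qed.

Lemma cyc_mulA a b c : cyc_mul a (cyc_mul b c) = cyc_mul (cyc_mul a b) c.
Proof.
apply/matrixP => k l; rewrite (ord1 l) [RHS]cyc_mulE.
under [RHS]eq_bigr => i _ do rewrite cyc_mulE mulr_suml.
rewrite cyc_mulE exchange_big; apply: eq_bigr => i _.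
rewrite cyc_mulE mulr_sumr [RHS](reindex_inj (addIr i)) /=.
by apply: eq_bigr => j _; rewrite addrK mulrA opprD [- j - i]addrC addrA.
Qed.

End CyclicAlgebra.

Section Differentiability.
Variable R : realType.

(* A map on U is represented by any total function extending it.  Since U is
   open in the intended uses, neither differentiability at the points of U nor
   the differentials there depend on the chosen extension. *)
Definition phi_differentiable (U : set 'cV[R]_3)
    (phi F : 'cV[R]_3 -> 'cV[R]_3) : Prop :=
  [/\ forall q, U q -> differentiable phi q,
      forall q, U q -> differentiable F q &
      exists F' : 'cV[R]_3 -> 'cV[R]_3, forall q, U q -> forall v : 'cV[R]_3,
        'd F q v = cyc_mul (F' q) ('d phi q v)].

Definition component (F : 'cV[R]_3 -> 'cV[R]_3) (i : 'I_3) : 'cV[R]_3 -> R :=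
  fun q => F q i 0.

Definition partial (W : normedModType R) (i : 'I_3) (f : 'cV[R]_3 -> W) :
    'cV[R]_3 -> W :=
  fun q => 'D_(basis3 R i) f q.

Definition laplacian (W : normedModType R) (f : 'cV[R]_3 -> W) :
    'cV[R]_3 -> W :=
  fun q => \sum_(i < 3) partial i (partial i f) q.

(* [partial] is a total operator, with an unspecified value where the limit
   does not exist, so the existence of the derivatives is required as well. *)
Definition C2_on (U : set 'cV[R]_3) (f : 'cV[R]_3 -> R) : Prop :=
  forall q, U q ->
    [/\ {for q, continuous f},
        forall i, derivable f q (basis3 R i) /\
                  {for q, continuous (partial i f)} &
        forall i j, derivable (partial i f) q (basis3 R j) /\
                    {for q, continuous (partial j (partial i f))}].

Definition harmonic_on (U : set 'cV[R]_3) (f : 'cV[R]_3 -> R) : Prop :=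
  C2_on U f /\ forall q, U q -> laplacian f q = 0.

Definition matA : 'M[R]_3 :=
  \matrix_(i, j) nth 0 (nth [::] [:: [:: -1; -1;  0];
                                     [::  1;  0; -1];
                                     [::  0;  1;  1]] i) j.

Definition affineA (k : 'cV[R]_3) : 'cV[R]_3 -> 'cV[R]_3 :=
  fun q => matA *m q + k.

End Differentiability.

(* Main.v *)
Require Import Defs.
From HB Require Import structures.
From mathcomp Require Import all_boot all_order all_algebra.
From mathcomp Require Import all_classical all_reals all_analysis.
From mathcomp Require Import ring lra.
Import Order.TTheory GRing.Theory Num.Theory.
Import numFieldNormedType.Exports.
Local Open Scope classical_set_scope.
Local Open Scope ring_scope.

Set Implicit Arguments.
Unset Strict Implicit.
Unset Printing Implicit Defensive.

(* The algebra is the product of R and C, and the columns of [matA] lie in the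
   ideal of vectors with zero sum, the factor C, where they are
   (w - 1), (w^2 - 1) and (w^2 - w) for a primitive cube root of unity w.  Hence
   [F] is, up to a locally constant R-component, a complex differentiable
   function of (w - 1) x + (w^2 - 1) y + (w^2 - w) z, and its Laplacian is the
   second derivative times (w - 1)^2 + (w^2 - 1)^2 + (w^2 - w)^2 = 0.

   As [F] is only assumed to be differentiable, everything lies in the existence
   and continuity of the second derivatives.  Goursat's bisection argument in
   polar coordinates around q, applied to the difference quotient at q, gives
   Cauchy's formula for the first derivative as a mean over an ellipse centred
   at q.  The resulting gradient bound, applied to F(p + h) - F(p), makes the
   derivative locally Lipschitz, and Cauchy's formula can then be differentiated
   under the integral sign.  Thus the derivative satisfies the same hypotheses
   as [F], and the argument can be iterated. *)

(** * Integrals of continuous functions over segments *)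

Section SegmentIntegral.
Context {R : realType}.
Implicit Types (f g : R -> R) (a b c e k : R).

(** This integral is unoriented: for [b < a] the segment is empty and the value is 0, so lengths and
    additivity below are stated for ordered endpoints. *)
Definition segint a b f : R := \int[lebesgue_measure]_(x in `[a, b]) f x.

Lemma continuous_inD a b f g : {in `[a, b], continuous f} ->
  {in `[a, b], continuous g} -> {in `[a, b], continuous (fun x => f x + g x)}.
Proof.
by move=> cf cg x xab; have fg := continuousD (cf x xab) (cg x xab); exact: fg.
Qed.

Lemma continuous_inZ a b k f : {in `[a, b], continuous f} ->
  {in `[a, b], continuous (fun x => k * f x)}.
Proof.
move=> cf x xab; have ck : {for x, continuous (fun _ : R => k)} by apply: cst_continuous.
by have kf := continuousM ck (cf x xab); exact: kf.
Qed.

Lemma segint_integrable a b f : {in `[a, b], continuous f} ->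
  (@lebesgue_measure R).-integrable `[a, b] (EFin \o f).
Proof.
move=> cf; apply: continuous_compact_integrable; first exact: segment_compact.
by apply: continuous_in_subspaceT => x /[!inE]/= xab; apply: cf.
Qed.

Lemma segintD a b f g : {in `[a, b], continuous f} ->
  {in `[a, b], continuous g} ->
  segint a b (fun x => f x + g x) = segint a b f + segint a b g.
Proof. by move=> cf cg; apply: RintegralD => //; apply: segint_integrable. Qed.

Lemma segintB a b f g : {in `[a, b], continuous f} ->
  {in `[a, b], continuous g} ->
  segint a b (fun x => f x - g x) = segint a b f - segint a b g.
Proof. by move=> cf cg; apply: RintegralB => //; apply: segint_integrable. Qed.

Lemma segintZ a b k f : {in `[a, b], continuous f} ->
  segint a b (fun x => k * f x) = k * segint a b f.
Proof. by move=> cf; apply: RintegralZl => //; apply: segint_integrable. Qed.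

Lemma segint_chasles a b c f : a <= b -> b <= c ->
  {in `[a, c], continuous f} -> segint a c f = segint a b f + segint b c f.
Proof.
move=> ab bc cf; have icf := segint_integrable cf.
apply/eqP; rewrite addrC -subr_eq; apply/eqP.
rewrite /segint Rintegral_itvB ?bnd_simp//.
rewrite Rintegral_itv_obnd_cbnd//; apply: integrableS icf => //.
by apply: subset_itvr; rewrite bnd_simp.
Qed.

Lemma segint_cst a b k : a <= b -> segint a b (cst k) = k * (b - a).
Proof.
move=> ab; rewrite /segint Rintegral_cst//= lebesgue_measure_itv/= lte_fin.
by move: ab; rewrite le_eqVlt => /predU1P[->|->]; rewrite ?ltxx ?subrr.
Qed.

(** Integrate [k - e <= f <= k + e]. With [k = 0] this is the usual bound on an integral; a general
    [k] serves to compare [f] with its expected value. *)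
Lemma segint_dist a b e k f : a <= b -> {in `[a, b], continuous f} ->
  {in `[a, b], forall x, `|f x - k| <= e} ->
  `|segint a b f - k * (b - a)| <= e * (b - a).
Proof.
move=> ab cf fe; have icf := segint_integrable cf.
have icst c : (@lebesgue_measure R).-integrable `[a, b] (EFin \o cst c).
  by apply: segint_integrable => x _; apply: cst_continuous.
rewrite ler_distl -!mulrBl -mulrDl -!segint_cst//.
by apply/andP; split; apply: le_Rintegral => // x /fe; rewrite ler_distl => /andP[].
Qed.

Lemma eq_segint a b f g : {in `[a, b], f =1 g} -> segint a b f = segint a b g.
Proof. by move=> fg; apply: eq_Rintegral => x /[!inE]/= /fg. Qed.

End SegmentIntegral.

(** * Goursat's theorem for closed forms on rectangles *)

Lemma near_dist_le (R : realType) (V : normedModType R) (x : V) (t : R) :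
  0 < t -> \forall z \near x, `|z - x| <= t.
Proof.
move=> t0; apply/nbhs_normP; exists t => // z /=; rewrite distrC.
exact: ltW.
Qed.

Section Goursat.
Context {R : realType}.
Implicit Types (P Q : R -> R -> R) (a b c d e x y h k : R).

(* [closed_at P Q x y]: P and Q are differentiable at (x, y), and there
   dP/dy = dQ/dx, so that the form P dx + Q dy is closed at this point. *)
Definition closed_at P Q x y := exists p q r, forall e, 0 < e ->
  exists2 t, 0 < t & forall x' y', `|x' - x| <= t -> `|y' - y| <= t ->
    `|P x' y' - (P x y + p * (x' - x) + q * (y' - y))|
        <= e * (`|x' - x| + `|y' - y|) /\
    `|Q x' y' - (Q x y + q * (x' - x) + r * (y' - y))|
        <= e * (`|x' - x| + `|y' - y|).

Definition closed_on P Q a b c d :=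
  forall x y, a <= x <= b -> c <= y <= d -> closed_at P Q x y.

(** The line integral of P dx + Q dy around the rectangle, counterclockwise: bottom minus top, then
    right minus left. *)
Definition circulation P Q a b c d : R :=
  segint a b (P^~ c) - segint a b (P^~ d) + (segint c d (Q b) - segint c d (Q a)).

(** Exchanging the coordinates lets facts about [P] on horizontal sides be reused for [Q] on
    vertical ones. *)
Lemma closed_at_sym P Q x y :
  closed_at P Q x y -> closed_at (fun y x => Q x y) (fun y x => P x y) y x.
Proof.
move=> [p [q [r H]]]; exists r, q, p => e /H[t t0 {}H].
exists t => // y' x' hy hx; have [h1 h2] := H _ _ hx hy.
by split; [move: h2|move: h1]; rewrite [`|x' - x| + _]addrC addrAC.
Qed.

Lemma closed_at_continuous P Q x y :
  closed_at P Q x y -> {for x, continuous (P^~ y)}.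
Proof.
move=> [p [q [r H]]]; apply/cvgrPdist_le => e e0.
have [t t0 {}H] := H _ ltr01.
have m0 : 0 < 1 + `|p| by rewrite ltr_pwDl.
near=> z.
have zt : `|z - x| <= t.
  by near: z; apply: (@near_dist_le R R^o).
have ze : `|z - x| <= e / (1 + `|p|).
  by near: z; apply: (@near_dist_le R R^o); rewrite divr_gt0.
have y0 : `|y - y| <= t by rewrite subrr normr0 ltW.
have [] := H _ _ zt y0; rewrite subrr normr0 mulr0 !addr0 mul1r => {}H _.
move: ze; rewrite ler_pdivlMr// => ze; rewrite distrC.
have -> : P z y - P x y = (P z y - (P x y + p * (z - x))) + p * (z - x) by ring.
apply: le_trans (ler_normD _ _) _; rewrite normrM; nra.
Unshelve. all: by end_near. Qed.

Lemma closed_on_continuous P Q a b c d y : closed_on P Q a b c d ->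
  c <= y <= d -> {in `[a, b], continuous (P^~ y)}.
Proof.
by move=> H cyd x; rewrite in_itv/= => axb; apply: closed_at_continuous (H _ _ _ _).
Qed.

Lemma closed_on_sym P Q a b c d : closed_on P Q a b c d ->
  closed_on (fun y x => Q x y) (fun y x => P x y) c d a b.
Proof. by move=> H y x hy hx; apply: closed_at_sym; apply: H. Qed.

(** The affine approximation of the form at (x, y) is itself closed and has no circulation, so only
    the remainder is left: it is of order [e] times the size of the rectangle, integrated over sides
    of that size. *)
Lemma circulation_local P Q x y e : closed_at P Q x y -> 0 < e ->
  exists2 t, 0 < t & forall a b c d, a <= x <= b -> c <= y <= d ->
    b - a <= t -> d - c <= t -> closed_on P Q a b c d ->
    `|circulation P Q a b c d| <= e * (b - a + (d - c)) ^+ 2.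
Proof.
(* Half of [e], because the remainders on two opposite sides add up. *)
move=> [p [q [r H]]] e0; have e20 : 0 < e / 2 by lra.
have [t t0 {}H] := H _ e20; exists t => // a b c d axb cyd bat dct cl.
have [ax xb] := andP axb; have [cy yd] := andP cyd.
have ab := le_trans ax xb; have cd := le_trans cy yd.
have cc : c <= c <= d by rewrite lexx. have dd : c <= d <= d by rewrite lexx andbT.
have aa : a <= a <= b by rewrite lexx. have bb : a <= b <= b by rewrite lexx andbT.
have cP z : c <= z <= d -> {in `[a, b], continuous (P^~ z)}.
  exact: closed_on_continuous cl.
have cQ z : a <= z <= b -> {in `[c, d], continuous (Q z)}.
  exact: (closed_on_continuous (closed_on_sym cl)).
have near_x z : a <= z <= b -> `|z - x| <= b - a.
  by rewrite ler_norml => /andP[? ?]; apply/andP; split; lra.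
have near_y z : c <= z <= d -> `|z - y| <= d - c.
  by rewrite ler_norml => /andP[? ?]; apply/andP; split; lra.
set s := b - a + (d - c).
have apx z w : a <= z <= b -> c <= w <= d ->
    `|P z w - (P x y + p * (z - x) + q * (w - y))| <= e / 2 * s /\
    `|Q z w - (Q x y + q * (z - x) + r * (w - y))| <= e / 2 * s.
  move=> hz hw; have [] := H z w.
  - exact: le_trans (near_x _ hz) bat.
  - exact: le_trans (near_y _ hw) dct.
  - move=> h1 h2.
    have hs : e / 2 * (`|z - x| + `|w - y|) <= e / 2 * s.
      by rewrite ler_pM2l// lerD// ?near_x ?near_y.
    by split; apply: le_trans hs.
rewrite /circulation -!segintB; [|exact: cQ|exact: cQ|exact: cP|exact: cP].
have dP : `|segint a b (fun z => P z c - P z d) - q * (c - d) * (b - a)|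
    <= e * s * (b - a).
  apply: segint_dist => // z.
    by move=> hz; apply: continuousB; apply: cP.
  rewrite in_itv/= => hz; have [h1 _] := apx _ _ hz cc; have [h2 _] := apx _ _ hz dd.
  have := ler_normB (P z c - (P x y + p * (z - x) + q * (c - y)))
    (P z d - (P x y + p * (z - x) + q * (d - y))).
  have -> : P z c - P z d - q * (c - d) = P z c - (P x y + p * (z - x) + q * (c - y)) -
    (P z d - (P x y + p * (z - x) + q * (d - y))) by ring.
  lra.
have dQ : `|segint c d (fun z => Q b z - Q a z) - q * (b - a) * (d - c)|
    <= e * s * (d - c).
  apply: segint_dist => // z.
    by move=> hz; apply: continuousB; apply: cQ.
  rewrite in_itv/= => hz; have [_ h1] := apx _ _ bb hz; have [_ h2] := apx _ _ aa hz.
  have := ler_normB (Q b z - (Q x y + q * (b - x) + r * (z - y)))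
    (Q a z - (Q x y + q * (a - x) + r * (z - y))).
  have -> : Q b z - Q a z - q * (b - a) = Q b z - (Q x y + q * (b - x) + r * (z - y)) -
    (Q a z - (Q x y + q * (a - x) + r * (z - y))) by ring.
  lra.
have := ler_normD (segint a b (fun z => P z c - P z d) - q * (c - d) * (b - a))
  (segint c d (fun z => Q b z - Q a z) - q * (b - a) * (d - c)).
set I := segint _ _ _; set J := segint _ _ _.
(* The linear terms cancel because [P] and [Q] share the coefficient [q], that is dP/dy = dQ/dx. *)
have -> : I - q * (c - d) * (b - a) + (J - q * (b - a) * (d - c)) = I + J by ring.
have -> : e * s ^+ 2 = e * s * (b - a) + e * s * (d - c) by rewrite /s; ring.
rewrite /I /J; lra.
Qed.

Lemma closed_onS P Q a b c d a' b' c' d' : a <= a' -> b' <= b -> c <= c' ->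
  d' <= d -> closed_on P Q a b c d -> closed_on P Q a' b' c' d'.
Proof.
move=> ? ? ? ? H x y /andP[? ?] /andP[? ?].
by apply: H; apply/andP; split; apply: le_trans; eassumption.
Qed.

(** Inner sides are run through twice in opposite directions, so the circulation is the sum over the
    four quarters, and one of them carries at least a fourth of it. *)
Lemma circulation_quarter P Q x y h k : 0 <= h -> 0 <= k ->
  closed_on P Q x (x + 2 * h) y (y + 2 * k) ->
  exists x' y', [/\ x <= x' <= x + h, y <= y' <= y + k &
    `|circulation P Q x (x + 2 * h) y (y + 2 * k)|
      <= 4 * `|circulation P Q x' (x' + h) y' (y' + k)|].
Proof.
move=> h0 k0 cl.
have cP z : y <= z <= y + 2 * k -> {in `[x, x + 2 * h], continuous (P^~ z)}.
  exact: closed_on_continuous cl.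
have cQ z : x <= z <= x + 2 * h -> {in `[y, y + 2 * k], continuous (Q z)}.
  exact: (closed_on_continuous (closed_on_sym cl)).
have sP z : y <= z <= y + 2 * k -> segint x (x + 2 * h) (P^~ z) =
    segint x (x + h) (P^~ z) + segint (x + h) (x + 2 * h) (P^~ z).
  by move=> hz; apply: segint_chasles (cP _ hz); lra.
have sQ z : x <= z <= x + 2 * h -> segint y (y + 2 * k) (Q z) =
    segint y (y + k) (Q z) + segint (y + k) (y + 2 * k) (Q z).
  by move=> hz; apply: segint_chasles (cQ _ hz); lra.
have split4 : circulation P Q x (x + 2 * h) y (y + 2 * k) =
    circulation P Q x (x + h) y (y + k) +
    circulation P Q (x + h) (x + h + h) y (y + k) +
    (circulation P Q x (x + h) (y + k) (y + k + k) +
     circulation P Q (x + h) (x + h + h) (y + k) (y + k + k)).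
  rewrite /circulation !sP ?sQ; try lra.
  have -> : x + h + h = x + 2 * h by ring.
  have -> : y + k + k = y + 2 * k by ring.
  ring.
have [|n1] := lerP `|circulation P Q x (x + 2 * h) y (y + 2 * k)|
  (4 * `|circulation P Q x (x + h) y (y + k)|).
  by exists x, y; split=> //; lra.
have [|n2] := lerP `|circulation P Q x (x + 2 * h) y (y + 2 * k)|
  (4 * `|circulation P Q (x + h) (x + h + h) y (y + k)|).
  by exists (x + h), y; split=> //; lra.
have [|n3] := lerP `|circulation P Q x (x + 2 * h) y (y + 2 * k)|
  (4 * `|circulation P Q x (x + h) (y + k) (y + k + k)|).
  by exists x, (y + k); split=> //; lra.
have [|n4] := lerP `|circulation P Q x (x + 2 * h) y (y + 2 * k)|
  (4 * `|circulation P Q (x + h) (x + h + h) (y + k) (y + k + k)|).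
  by exists (x + h), (y + k); split=> //; lra.
exfalso; move: n1 n2 n3 n4; rewrite split4.
set A := circulation _ _ _ _ _ _; set B := circulation _ _ _ _ _ _.
set C := circulation _ _ _ _ _ _; set D := circulation _ _ _ _ _ _.
have := ler_normD (A + B) (C + D); have := ler_normD A B.
have := ler_normD C D; lra.
Qed.

(* Bisection: otherwise nested rectangles of size 2^-n would all carry a
   circulation of order 4^-n, against [circulation_local] at their limit. *)
Lemma goursat P Q a b c d : a <= b -> c <= d -> closed_on P Q a b c d ->
  circulation P Q a b c d = 0.
Proof.
move=> ab cd cl; apply/eqP; rewrite -normr_le0 leNgt; apply/negP => C0.
set K := `|circulation P Q a b c d| in C0.
(* A rectangle of generation [n] is recorded by its lower left corner [z]; its sides are those of
   the original one divided by 2^n. *)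
pose inside (n : nat) (z : R * R) := [/\ a <= z.1, z.1 + (b - a) / 2 ^+ n <= b,
  c <= z.2 & z.2 + (d - c) / 2 ^+ n <= d].
pose circ (n : nat) (z : R * R) := circulation P Q z.1 (z.1 + (b - a) / 2 ^+ n)
  z.2 (z.2 + (d - c) / 2 ^+ n).
have half (n : nat) h : h / 2 ^+ n = 2 * (h / 2 ^+ n.+1).
  by rewrite exprS; field; rewrite expf_neq0.
have pw (n : nat) : 0 < 2 ^+ n :> R by rewrite exprn_gt0.
(* The hypothesis sits under the existential so that [choice] yields a total successor function;
   where it fails, the witness 0 is arbitrary. *)
have step (nz : nat * (R * R)) : exists w, inside nz.1 nz.2 ->
    [/\ inside nz.1.+1 w, nz.2.1 <= w.1 <= nz.2.1 + (b - a) / 2 ^+ nz.1.+1,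
      nz.2.2 <= w.2 <= nz.2.2 + (d - c) / 2 ^+ nz.1.+1 &
      `|circ nz.1 nz.2| <= 4 * `|circ nz.1.+1 w|].
  case: nz => n [x y] /=.
  have [[/= i1 i2 i3 i4]|?] := pselect (inside n (x, y)); last by exists 0.
  set h := (b - a) / 2 ^+ n.+1; set k := (d - c) / 2 ^+ n.+1.
  have h0 : 0 <= h by rewrite divr_ge0 ?subr_ge0// ltW.
  have k0 : 0 <= k by rewrite divr_ge0 ?subr_ge0// ltW.
  have hE : (b - a) / 2 ^+ n = 2 * h := half n (b - a).
  have kE : (d - c) / 2 ^+ n = 2 * k := half n (d - c).
  rewrite hE in i2; rewrite kE in i4.
  have [|x' [y' [hx hy hc]]] :=
      @circulation_quarter P Q x y h k h0 k0.
    by apply: closed_onS cl.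
  exists (x', y') => _; move: (hx) (hy) => /andP[? ?] /andP[? ?]; split=> //=.
  - by split=> /=; rewrite -/h -/k; lra.
  - by rewrite /circ /= hE kE -/h -/k.
have [f fP] := choice step.
pose z := fix z (n : nat) : R * R := if n is m.+1 then f (m, z m) else (a, c).
have zin n : inside n (z n).
  elim: n => [|n IH]; last by have [] := fP (n, z n) IH.
  by split; rewrite /= ?expr0 ?divr1; lra.
have zK n : K <= 4 ^+ n * `|circ n (z n)|.
  elim: n => [|n IH].
    rewrite expr0 mul1r /K /circ /= expr0 !divr1.
    by rewrite [a + _]addrC subrK [c + _]addrC subrK.
  have [_ _ _ /= h] := fP (n, z n) (zin n).
  by apply: le_trans IH _; rewrite [4 ^+ n.+1]exprSr -mulrA ler_pM2l ?exprn_gt0.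
have zinc n m : (n <= m)%N -> [/\ (z n).1 <= (z m).1,
    (z m).1 + (b - a) / 2 ^+ m <= (z n).1 + (b - a) / 2 ^+ n,
    (z n).2 <= (z m).2 &
    (z m).2 + (d - c) / 2 ^+ m <= (z n).2 + (d - c) / 2 ^+ n].
  move=> nm; rewrite -(subnKC nm); elim: (m - n)%N => [|l [IH1 IH2 IH3 IH4]].
    by rewrite addn0; split.
  have /= [_ /andP[h1 h2] /andP[h3 h4] _] := fP ((n + l)%N, z (n + l)%N) (zin _).
  rewrite addnS; move: IH2 IH4; rewrite (half (n + l)%N (b - a)) (half (n + l)%N (d - c)).
  move: h2 h4; set h := _ / 2 ^+ (n + l).+1; set k := _ / 2 ^+ (n + l).+1.
  move=> h2 h4 IH2 IH4.
  by split; rewrite /=; lra.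
have bax n : 0 <= (b - a) / 2 ^+ n by rewrite divr_ge0 ?subr_ge0// ltW.
have dcx n : 0 <= (d - c) / 2 ^+ n by rewrite divr_ge0 ?subr_ge0// ltW.
have lx n m : (z n).1 <= (z m).1 + (b - a) / 2 ^+ m.
  have [/zinc[+ _ _ _]|/ltnW/zinc[_ + _ _]] := leqP n m.
    by have := bax m; lra.
  by have := bax n; lra.
have ly n m : (z n).2 <= (z m).2 + (d - c) / 2 ^+ m.
  have [/zinc[_ _ + _]|/ltnW/zinc[_ _ _]] := leqP n m.
    by have := dcx m; lra.
  by have := dcx n; lra.
(* The supremum of the lower left corners, coordinate by coordinate, is a common point of all the
   nested rectangles. *)
pose x := sup (range (fun n => (z n).1)); pose y := sup (range (fun n => (z n).2)).
have xP n : (z n).1 <= x <= (z n).1 + (b - a) / 2 ^+ n.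
  apply/andP; split.
    apply: ub_le_sup; last by exists n.
    by exists ((z 0%N).1 + (b - a) / 2 ^+ 0) => _ [m _ <-].
  by apply: ge_sup; [exists (z 0%N).1, 0%N|move=> _ [m _ <-]].
have yP n : (z n).2 <= y <= (z n).2 + (d - c) / 2 ^+ n.
  apply/andP; split.
    apply: ub_le_sup; last by exists n.
    by exists ((z 0%N).2 + (d - c) / 2 ^+ 0) => _ [m _ <-].
  by apply: ge_sup; [exists (z 0%N).2, 0%N|move=> _ [m _ <-]].
have clxy : closed_at P Q x y.
  have /andP[x1 x2] := xP 0%N; have /andP[y1 y2] := yP 0%N.
  have [z1 z2 z3 z4] := zin 0%N.
  by apply: cl; apply/andP; split; lra.
set S := b - a + (d - c).
have S0 : 0 <= S by rewrite /S; lra.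
(* Chosen so that [e * S ^+ 2 < K]; the summand 1 keeps the denominator positive when the rectangle
   is a point. *)
pose e := K / (2 * (S ^+ 2 + 1)).
have S2 : 0 < 2 * (S ^+ 2 + 1) by have := sqr_ge0 S; lra.
have e0 : 0 < e by rewrite divr_gt0.
have [t t0 ht] := circulation_local clxy e0.
have [n nt] : exists n : nat, S / 2 ^+ n <= t.
  exists (Num.bound (S / t)); rewrite ler_pdivrMr// mulrC -ler_pdivrMr//.
  apply: le_trans (ltW (archi_boundP (divr_ge0 S0 (ltW t0)))) _.
  by rewrite -natrX ler_nat ltnW// ltn_expl.
have [i1 i2 i3 i4] := zin n.
have := ht (z n).1 ((z n).1 + (b - a) / 2 ^+ n) (z n).2
  ((z n).2 + (d - c) / 2 ^+ n) (xP n) (yP n).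
rewrite ![_ + _ / _ - _]addrAC !subrr !add0r -mulrDl -/S -/(circ n (z n)).
have wt w : w <= S -> w / 2 ^+ n <= t.
  by move=> wS; apply: le_trans nt; rewrite ler_pM2r ?invr_gt0.
have baS : b - a <= S by rewrite /S; lra.
have dcS : d - c <= S by rewrite /S; lra.
move=> /(_ (wt _ baS) (wt _ dcS) (closed_onS i1 i2 i3 i4 cl)) hC; have := zK n.
apply/negP; rewrite -ltNge.
have -> : 4 ^+ n = (2 ^+ n) ^+ 2 :> R.
  by rewrite (_ : 4 = 2 ^+ 2); [rewrite -!exprM mulnC|ring].
apply: (@le_lt_trans _ _ (e * S ^+ 2)).
  apply: le_trans (_ : (2 ^+ n) ^+ 2 * (e * (S / 2 ^+ n) ^+ 2) <= _).
    by rewrite ler_pM2l ?exprn_gt0.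
  by rewrite le_eqVlt; apply/orP; left; apply/eqP; field; rewrite expf_neq0.
rewrite /e mulrAC ltr_pdivrMr//. rewrite ltr_pM2l//; have := sqr_ge0 S; lra.
Qed.

End Goursat.

(** * Difference quotients in polar coordinates *)

Section Approximation.
Context {R : realType} {V W : normedModType R}.

Lemma diff_approx (f : V -> W) x e : differentiable f x -> 0 < e ->
  exists2 t, 0 < t & forall z, `|z - x| <= t ->
    `|f z - (f x + 'd f x (z - x))| <= e * `|z - x|.
Proof.
move=> df e0; have := diff_locally df => /eqaddoP/(_ e e0).
move=> /nbhs_normP[t /= t0 H]; exists (t / 2); first by rewrite divr_gt0.
move=> z zx; have := H (z - x); rewrite /= sub0r normrN.
rewrite (_ : f z = f (z - x + x)); last by rewrite subrK.
by apply; apply: le_lt_trans zx _; lra.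
Qed.

End Approximation.

Section Polar.
Context {R : realType}.

Lemma closed_at_diff (P Q dP dQ : R * R -> R) x y :
  is_diff (x, y) P dP -> is_diff (x, y) Q dQ -> dP (0, 1) = dQ (1, 0) ->
  closed_at (fun x y => P (x, y)) (fun x y => Q (x, y)) x y.
Proof.
move=> hP hQ dPQ.
have lin (f df : R * R -> R) : is_diff (x, y) f df -> forall h k,
    'd f (x, y) (h, k) = df (1, 0) * h + df (0, 1) * k.
  move=> hf h k; have <- : 'd f (x, y) = df :> (_ -> _) by exact: diff_val.
  have -> : (h, k) = h *: (1, 0) + k *: (0, 1) :> R * R.
    rewrite [RHS]surjective_pairing; congr pair; rewrite /=.
      by rewrite [h *: _]mulr1 [k *: _]mulr0 addr0.
    by rewrite [h *: _]mulr0 [k *: _]mulr1 add0r.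
  by rewrite linearD !linearZ /= ![_ *: _]mulrC.
exists (dP (1, 0)), (dQ (1, 0)), (dQ (0, 1)) => e e0.
have [t t0 H] := diff_approx (ex_diff : differentiable P (x, y)) e0.
have [s s0 K] := diff_approx (ex_diff : differentiable Q (x, y)) e0.
exists (Num.min s t); first by rewrite lt_min s0.
move=> x' y'; rewrite !le_min => /andP[x1 x2] /andP[y1 y2].
have n1 : `|(x', y') - (x, y) : R * R| <= `|x' - x| + `|y' - y|.
  by rewrite prod_normE/= ge_max lerDl lerDr !normr_ge0.
have n2 w : `|x' - x| <= w -> `|y' - y| <= w -> `|(x', y') - (x, y) : R * R| <= w.
  by move=> ? ?; rewrite prod_normE/= ge_max; apply/andP.
split.
  have := H _ (n2 _ x2 y2); rewrite (lin _ _ hP) dPQ addrA => /le_trans; apply.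
  by rewrite ler_pM2l.
have := K _ (n2 _ x1 y1); rewrite (lin _ _ hQ) addrA => /le_trans; apply.
by rewrite ler_pM2l.
Qed.

Lemma is_diff_derive1 (f : R -> R) (x d : R) :
  is_derive x 1 f d -> is_diff x f ( *%R^~ d).
Proof.
move=> df; have df1 : derivable f x 1 by [].
apply: DiffDef; first exact/derivable1_diffP.
by rewrite deriv1E// derive1E derive_val.
Qed.

Lemma is_diff_fst (z : R * R) : is_diff z fst fst.
Proof.
have c : continuous (fst : R * R -> R) by move=> ?; apply: cvg_fst.
by apply: DiffDef; [exact: linear_differentiable|exact: diff_lin].
Qed.

Lemma is_diff_snd (z : R * R) : is_diff z snd snd.
Proof.
have c : continuous (snd : R * R -> R) by move=> ?; apply: cvg_snd.
by apply: DiffDef; [exact: linear_differentiable|exact: diff_lin].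
Qed.

Context {V : normedModType R}.
Implicit Types (u v : V -> R) (q a b : V) (r t : R).

(** The point q + r exp(i t), where [a] and [b] stand for 1 and i; circles become ellipses in V. *)
Definition polar q a b r t : V := q + ((r * cos t) *: a + (r * sin t) *: b).

(* [u + i v] is complex differentiable at [p] along the plane in which [a] and
   [b] play the roles of 1 and i. *)
Definition cauchy_riemann u v a b p := [/\ differentiable u p, differentiable v p,
  'd v p b = 'd u p a & 'd u p b = - 'd v p a].

(* Real and imaginary parts of (f(z) - f(q)) / (z - q) for f = u + i v. *)
Definition slope_re u v q a b r t := r^-1 *
  ((u (polar q a b r t) - u q) * cos t + (v (polar q a b r t) - v q) * sin t).
Definition slope_im u v q a b r t := r^-1 *
  ((v (polar q a b r t) - v q) * cos t - (u (polar q a b r t) - u q) * sin t).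

Lemma is_diff_cos (r t : R) :
  is_diff (r, t) (fun z : R * R => cos z.2) (fun h => h.2 * (- sin t)).
Proof.
have h1 : is_diff ((r, t).2 : R) (@cos R) ( *%R^~ (- sin t)) by exact: is_diff_derive1.
exact: (is_diff_comp (is_diff_snd (r, t)) h1).
Qed.

Lemma is_diff_sin (r t : R) :
  is_diff (r, t) (fun z : R * R => sin z.2) (fun h => h.2 * cos t).
Proof.
have h1 : is_diff ((r, t).2 : R) (@sin R) ( *%R^~ (cos t)) by exact: is_diff_derive1.
exact: (is_diff_comp (is_diff_snd (r, t)) h1).
Qed.

Lemma is_diff_invr (r t : R) : 0 < r ->
  is_diff (r, t) (fun z : R * R => z.1^-1) (fun h => - (r ^+ 2)^-1 * h.1).
Proof.
move=> r0; have d1 := is_diff_fst (r, t).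
have h0 : (r, t).1 != 0 :> R by rewrite gt_eqF.
apply: DiffDef; first exact: differentiableV.
by apply/funext => h; rewrite (@diffV _ _ (fst : R * R -> R))// diff_val.
Qed.

Lemma is_diff_polar q a b r t :
  is_diff (r, t) (fun z => polar q a b z.1 z.2)
    (fun h => (h.1 * cos t - r * h.2 * sin t) *: a
      + (h.1 * sin t + r * h.2 * cos t) *: b).
Proof.
have d1 := is_diff_fst (r, t).
have dcos := is_diff_cos r t; have dsin := is_diff_sin r t.
have dc : is_diff (r, t) (fun z : R * R => z.1 * cos z.2)
    (fun h => h.1 * cos t - r * h.2 * sin t).
  apply: is_diff_eq; apply/funext => h; rewrite addrfctE !scalrfctE /=.
  rewrite /GRing.scale/=; ring.
have ds : is_diff (r, t) (fun z : R * R => z.1 * sin z.2)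
    (fun h => h.1 * sin t + r * h.2 * cos t).
  apply: is_diff_eq; apply/funext => h; rewrite addrfctE !scalrfctE /=.
  rewrite /GRing.scale/=; ring.
have da := is_diff_comp dc (is_diff_scalel _ a).
have db := is_diff_comp ds (is_diff_scalel _ b).
have dD := is_diffD (is_diff_cst q (r, t)) (is_diffD da db).
by apply: is_diff_eq; apply/funext => h; rewrite !addrfctE/= add0r.
Qed.

Lemma is_diff_along_polar u q a b r t c : differentiable u (polar q a b r t) ->
  is_diff (r, t) (fun z => u (polar q a b z.1 z.2) - c)
    (fun h => (h.1 * cos t - r * h.2 * sin t) * 'd u (polar q a b r t) a
      + (h.1 * sin t + r * h.2 * cos t) * 'd u (polar q a b r t) b).
Proof.
move=> /differentiableP du.
have d := is_diffB (is_diff_comp (is_diff_polar q a b r t) du) (is_diff_cst c (r, t)).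
apply: is_diff_eq; apply/funext => h.
by rewrite /GRing.add/= /GRing.opp/= oppr0 addr0 linearD !linearZ.
Qed.

(** Since dz / (z - q) = dr / r + i dt, this form is the imaginary part of g(z) dz / (z - q), with g
    the difference quotient at [q]. It is closed because g is complex differentiable away from
    [q]. *)
Lemma slope_closed u v q a b r t : 0 < r ->
  cauchy_riemann u v a b (polar q a b r t) ->
  closed_at (fun r t => r^-1 * slope_im u v q a b r t) (slope_re u v q a b) r t.
Proof.
move=> r0 [du dv cr1 cr2].
have dinv := is_diff_invr t r0.
have dcos := is_diff_cos r t; have dsin := is_diff_sin r t.
have := is_diff_along_polar (u q) du; have := is_diff_along_polar (v q) dv.
rewrite cr1 cr2; set A := 'd u _ a; set B := 'd v _ a => dV dU.
apply: (@closed_at_diff (fun z => z.1^-1 * slope_im u v q a b z.1 z.2)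
  (fun z => slope_re u v q a b z.1 z.2)).
rewrite ?(addrfctE, scalrfctE, opprfctE) /slope_im /= /GRing.scale /=.
set X := v _ - v q; set Y := u _ - u q; clearbody X Y A B.
by field; rewrite gt_eqF.
Qed.

Lemma polar0 q a b t : polar q a b 0 t = q.
Proof. by rewrite /polar !mul0r !scale0r !addr0. Qed.

Lemma polar_dist q a b r t : 0 <= r ->
  `|polar q a b r t - q| <= r * (`|a| + `|b|).
Proof.
move=> r0; rewrite /polar addrC addKr (le_trans (ler_normD _ _))// !normrZ.
rewrite mulrDr ger0_norm// lerD//.
  by rewrite ler_wpM2r// -[leRHS]mulr1 ler_wpM2l// cos_max.
by rewrite ler_wpM2r// -[leRHS]mulr1 ler_wpM2l// sin_max.
Qed.

(** The difference quotient tends to the derivative uniformly in the angle, and ['d u q a] is the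
    real part of the derivative. *)
Lemma slope_re_near u v q a b e : cauchy_riemann u v a b q -> 0 < e ->
  exists2 d, 0 < d & forall r t, 0 < r <= d ->
    `|slope_re u v q a b r t - 'd u q a| <= e.
Proof.
set M := `|a| + `|b|.
have M0 : 0 <= M by rewrite addr_ge0.
have M1 : 0 < M + 1 by rewrite ltr_wpDl.
have M2 : 0 < 2 * M + 1 by rewrite ltr_wpDl ?mulr_ge0.
have leM1 : M <= M + 1 by rewrite lerDl.
move=> [du dv cr1 cr2] e0.
(* The two remainders together are at most [2 * k * (r * M)], which after division by [r] stays
   below [e]. *)
pose k := e / (2 * M + 1).
have k0 : 0 < k by rewrite divr_gt0.
have kE : k * (2 * M + 1) = e by rewrite divfK ?gt_eqF.
have [d1 d10 H1] := diff_approx du k0; have [d2 d20 H2] := diff_approx dv k0.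
exists (Num.min d1 d2 / (M + 1)).
  by rewrite divr_gt0 ?lt_min ?d10.
move=> r t /andP[r0 rd]; set p := polar q a b r t.
have pq : `|p - q| <= r * M by apply: polar_dist; rewrite ltW.
have : `|p - q| <= Num.min d1 d2.
  apply: le_trans pq _; move: rd; rewrite ler_pdivlMr//.
  by apply: le_trans; rewrite ler_pM2l.
rewrite le_min => /andP[/H1 h1 /H2 h2].
have E w : 'd w q (p - q) = r * (cos t * 'd w q a + sin t * 'd w q b) :> R.
  by rewrite /p /polar [q + _]addrC addrK linearD !linearZ /= mulrDr !mulrA.
rewrite (E u) cr2 in h1; rewrite (E v) cr1 in h2; move: h1 h2.
rewrite /slope_re -/p.
move: ('d u q a : R) ('d v q a : R) (u p) (v p) (u q) (v q) => A B up vp uq vq.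
rewrite !opprD !addrA.
set X := up - uq - _; set Y := vp - vq - _ => h1 h2.
(* The vanishing term with cos^2 + sin^2 - 1 is kept explicit so that the identity is purely
   rational and [field] can prove it. *)
have -> : r^-1 * ((up - uq) * cos t + (vp - vq) * sin t) - A
    = r^-1 * (X * cos t + Y * sin t) + (cos t ^+ 2 + sin t ^+ 2 - 1) * A.
  by rewrite /X /Y; field; rewrite gt_eqF.
rewrite cos2Dsin2 subrr mul0r addr0 normrM gtr0_norm ?invr_gt0// mulrC.
rewrite ler_pdivrMr// (le_trans (ler_normD _ _))// !normrM.
apply: (@le_trans _ _ (`|X| * 1 + `|Y| * 1)).
  by rewrite lerD// ler_wpM2l// ?cos_max ?sin_max.
rewrite !mulr1; apply: le_trans (lerD h1 h2) _.
rewrite -kE; have : k * `|p - q| <= k * (r * M) by rewrite ler_pM2l.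
have : 0 <= k * r by rewrite mulr_ge0 ?ltW.
by clear; lra.
Qed.

(* The closed form (Im g / r) dr + (Re g) dt, with g the difference quotient at
   [q], makes the mean of Re g over circles independent of the radius. *)
Lemma polar_mean_value u v q a b r : 0 < r ->
  (forall s t, 0 <= s <= r -> cauchy_riemann u v a b (polar q a b s t)) ->
  segint 0 (pi *+ 2) (slope_re u v q a b r) = 'd u q a * (pi *+ 2).
Proof.
move=> r0 H; have pi0 : 0 <= pi *+ 2 :> R by rewrite mulrn_wge0 ?pi_ge0.
have cl s : 0 < s -> closed_on (fun r t => r^-1 * slope_im u v q a b r t)
    (slope_re u v q a b) s r 0 (pi *+ 2).
  move=> s0 x y /andP[sx xr] _; apply: slope_closed; first exact: lt_le_trans sx.
  by apply: H; rewrite xr (le_trans (ltW s0)).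
(* Goursat on [s, r] x [0, 2 pi]: the sides t = 0 and t = 2 pi carry the same integrand and cancel.
   The factor 1/r forces [s > 0]. *)
have const s : 0 < s <= r -> segint 0 (pi *+ 2) (slope_re u v q a b r) =
    segint 0 (pi *+ 2) (slope_re u v q a b s).
  move=> /andP[s0 sr]; have := goursat sr pi0 (cl _ s0); rewrite /circulation.
  rewrite (_ : (fun x => x^-1 * slope_im u v q a b x 0) =
      (fun x => x^-1 * slope_im u v q a b x (pi *+ 2))) ?subrr ?add0r.
    by move=> /eqP; rewrite subr_eq0 => /eqP.
  apply/funext => x; congr (_ * _).
  by rewrite /slope_im /polar cos0 sin0 cos2pi sin2pi.
(* It remains to let the radius tend to 0, where the integrand is uniformly close to ['d u q a]. *)
apply/eqP; rewrite -subr_eq0 -normr_le0; apply/ler_addgt0Pr => e e0; rewrite add0r.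
have cr : cauchy_riemann u v a b q.
  by rewrite -(polar0 q a b 0); apply: H; rewrite lexx ltW.
have pi20 : 0 < pi *+ 2 :> R by rewrite mulrn_wgt0// pi_gt0.
have k0 : 0 < e / (pi *+ 2) by rewrite divr_gt0.
have [d d0 near_q] := slope_re_near cr k0.
pose s := Num.min d r.
have s0 : 0 < s by rewrite lt_min d0.
have sd : s <= d by rewrite ge_min lexx.
have sr : s <= r by rewrite ge_min lexx orbT.
rewrite (const s) ?s0//.
have := @segint_dist _ 0 (pi *+ 2) (e / (pi *+ 2)) ('d u q a) (slope_re u v q a b s) pi0.
rewrite subr0 divfK ?gt_eqF//; apply.
- by apply: (closed_on_continuous (closed_on_sym (cl _ s0))); rewrite lexx.
- by move=> t _; apply: near_q; rewrite s0.
Qed.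

End Polar.

(** * The ideal of vectors with zero sum *)

Section CyclicAlgebraBounds.
Context {R : realType}.
Implicit Types (a b c v w z : 'cV[R]_3).

Lemma sum3E (M : nmodType) (f : 'I_3 -> M) : \sum_(i < 3) f i = f 0 + f 1 + f 2.
Proof.
rewrite !big_ord_recr big_ord0 /= add0r.
by congr (f _ + f _ + f _); apply: val_inj.
Qed.

Lemma ord3P (P : 'I_3 -> Prop) : P 0 -> P 1 -> P 2 -> forall i, P i.
Proof.
move=> P0 P1 P2 [[|[|[|//]]] Hi].
- by rewrite (_ : Ordinal Hi = 0) //; apply: val_inj.
- by rewrite (_ : Ordinal Hi = 1) //; apply: val_inj.
- by rewrite (_ : Ordinal Hi = 2) //; apply: val_inj.
Qed.

Lemma eq_cV3 v w : v 0 0 = w 0 0 -> v 1 0 = w 1 0 -> v 2 0 = w 2 0 -> v = w.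
Proof.
by move=> h0 h1 h2; apply/matrixP => i j; rewrite (ord1 j); elim/ord3P: i.
Qed.

Lemma basis3E (i j : 'I_3) : basis3 R i j 0 = (j == i)%:R.
Proof. by rewrite mxE eqxx andbT. Qed.

Lemma cyc_mul0E a b : cyc_mul a b 0 0 = a 0 0 * b 0 0 + a 1 0 * b 2 0 + a 2 0 * b 1 0.
Proof.
rewrite cyc_mulE sum3E; congr (_ + _ * b _ _ + _ * b _ _); first by rewrite subr0.
all: exact: val_inj.
Qed.

Lemma cyc_mul1E a b : cyc_mul a b 1 0 = a 0 0 * b 1 0 + a 1 0 * b 0 0 + a 2 0 * b 2 0.
Proof.
rewrite cyc_mulE sum3E; congr (_ * b _ _ + _ * b _ _ + _ * b _ _).
all: exact: val_inj.
Qed.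

Lemma cyc_mul2E a b : cyc_mul a b 2 0 = a 0 0 * b 2 0 + a 1 0 * b 1 0 + a 2 0 * b 0 0.
Proof.
rewrite cyc_mulE sum3E; congr (_ * b _ _ + _ * b _ _ + _ * b _ _).
all: exact: val_inj.
Qed.

Definition cyc_mul3E := (cyc_mul0E, cyc_mul1E, cyc_mul2E).

Lemma normr_coord v i : `|v i 0| <= `|v|.
Proof.
by rewrite [leRHS]/Num.Def.normr/= mx_normrE; exact: (le_bigmax _ _ (i, 0)).
Qed.

Lemma normr_cV_le v e : 0 <= e -> (forall i, `|v i 0| <= e) -> `|v| <= e.
Proof.
move=> e0 ve; rewrite [leLHS]/Num.Def.normr/= mx_normrE.
by apply: bigmax_le => // -[i j] _ /=; rewrite (ord1 j).
Qed.

(** The norm is the maximum of the absolute coordinates, and each coordinate of a product is a sum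
    of three terms. *)
Lemma normr_cyc_mul a b : `|cyc_mul a b| <= 3 * `|a| * `|b|.
Proof.
apply: normr_cV_le => [|k]; first by rewrite !mulr_ge0.
rewrite cyc_mulE (le_trans (ler_norm_sum _ _ _))//.
apply: (@le_trans _ _ (\sum_(i < 3) (`|a| * `|b|))); last first.
  by rewrite sum3E -mulrA; lra.
by apply: ler_sum => i _; rewrite normrM ler_pM// normr_coord.
Qed.

(* The columns of [matA] are algebra multiples of the last one, e_3 - e_2; the
   factors are e_3, - e_2 and 1. *)
Definition dir v : 'cV[R]_3 :=
  v 2 0 *: basis3 R 0 - v 1 0 *: basis3 R 1 + v 0 0 *: basis3 R 2.

Lemma dirD v w : dir (v + w) = dir v + dir w.
Proof. by apply: eq_cV3; rewrite !mxE; ring. Qed.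

Lemma dirZ t v : dir (t *: v) = t *: dir v.
Proof. by apply: eq_cV3; rewrite !mxE; ring. Qed.

Lemma dir_basis2 : dir (basis3 R 2) = basis3 R 0.
Proof. by apply: eq_cV3; rewrite !mxE /=; ring. Qed.

Lemma dirE v : [/\ dir v 0 0 = v 2 0, dir v 1 0 = - v 1 0 & dir v 2 0 = v 0 0].
Proof. by split; rewrite !mxE /=; ring. Qed.

Lemma normr_dir v : `|dir v| <= `|v|.
Proof.
have [h0 h1 h2] := dirE v; apply: normr_cV_le => //; elim/ord3P.
- by rewrite h0 normr_coord.
- by rewrite h1 normrN normr_coord.
- by rewrite h2 normr_coord.
Qed.

Lemma matA_dir v : matA R *m v = cyc_mul (dir v) (matA R *m basis3 R 2).
Proof.
have [h0 h1 h2] := dirE v.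
by apply: eq_cV3; rewrite cyc_mul3E h0 h1 h2 !mxE !sum3E !mxE /=; ring.
Qed.

(** The coordinate sum is the projection onto the factor R of the algebra, hence multiplicative. *)
Lemma sum_cyc_mul a b :
  \sum_(i < 3) cyc_mul a b i 0 = (\sum_(i < 3) a i 0) * \sum_(i < 3) b i 0.
Proof. by rewrite !sum3E !cyc_mul3E; ring. Qed.

Lemma sum_matA v : \sum_(i < 3) (matA R *m v) i 0 = 0.
Proof. by rewrite sum3E !mxE !sum3E !mxE /=; ring. Qed.

(** The three factors e_3, - e_2 and e have squares e_2, e_3 and e. Multiplication by e + e_2 + e_3
    only sees the coordinate sum of [z], which is 0. This is the identity that annihilates the
    Laplacian. *)
Lemma sum_dir_sqr z : \sum_(i < 3) z i 0 = 0 ->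
  \sum_(i < 3) cyc_mul (dir (basis3 R i)) (cyc_mul (dir (basis3 R i)) z) = 0.
Proof.
rewrite !sum3E => z0.
have sq i : dir (basis3 R i) =
    if i == 0 then basis3 R 2 else if i == 1 then - basis3 R 1 else basis3 R 0.
  by elim/ord3P: i; apply: eq_cV3; rewrite !mxE /=; ring.
rewrite !sq /=; apply: eq_cV3; rewrite !mxE !cyc_mul3E !mxE /=; lra.
Qed.

(** In the complex factor this is (w - w^2) / sqrt 3, a square root of -1. *)
Definition unit_i : 'cV[R]_3 := (Num.sqrt 3)^-1 *: (basis3 R 1 - basis3 R 2).
(** The direction that [dir] sends to [unit_i]: moving along it multiplies the derivative along
    [basis3 R 2] by i. *)
Definition dir_i : 'cV[R]_3 := - ((Num.sqrt 3)^-1 *: (basis3 R 0 + basis3 R 1)).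

Lemma dir_dir_i : dir dir_i = unit_i.
Proof. by apply: eq_cV3; rewrite !mxE /=; ring. Qed.

Lemma unit_i_sqr z : \sum_(i < 3) z i 0 = 0 -> cyc_mul unit_i (cyc_mul unit_i z) = - z.
Proof.
rewrite sum3E => z0.
have s3 : (Num.sqrt 3)^-1 * (Num.sqrt 3)^-1 = 3^-1 :> R.
  by rewrite -invfM -expr2 sqr_sqrtr.
rewrite /unit_i !cyc_mulZl cyc_mulZr scalerA s3.
by apply: eq_cV3; rewrite !mxE !cyc_mul3E !mxE /=; lra.
Qed.

End CyclicAlgebraBounds.

(** * Differentiability criteria and the mean value theorem *)

Section Calculus.
Context {R : realType}.
Notation V := 'cV[R]_3.
Implicit Types (F G : V -> V) (q v w z h : V).

Lemma is_diff_linear (W W' : normedModType R) (L : {linear W -> W'}) x :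
  continuous L -> is_diff x L L.
Proof.
by move=> Lc; apply: DiffDef; [exact: linear_differentiable|exact: diff_lin].
Qed.

Lemma coord_linear (i : 'I_3) : linear (fun w : V => w i 0 : R).
Proof. by move=> t v w; rewrite !mxE. Qed.

Lemma is_diff_coord (U : normedModType R) (F dF : U -> V) (i : 'I_3) (q : U) :
  is_diff q F dF ->
  is_diff q (fun p => F p i 0) (fun p => dF p i 0).
Proof.
move=> hF.
pose L : {linear V -> R} := HB.pack (fun w : V => w i 0 : R)
  (GRing.isLinear.Build _ _ _ _ _ (coord_linear i)).
have hL : is_diff (F q) L L by apply: is_diff_linear; exact: coord_continuous.
exact: (is_diff_comp hF hL).
Qed.

Lemma lipschitz_linear_continuous (W W' : normedModType R) (L : {linear W -> W'}) k :
  (forall w : W, `|L w| <= k * `|w|) -> continuous L.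
Proof.
move=> Lk; apply: bounded_linear_continuous; apply/linear_boundedP.
exists k; split; first exact: num_real.
by move=> r kr w; apply: le_trans (Lk w) _; rewrite ler_wpM2r// ltW.
Qed.

(** A quadratic remainder is o(h); the bound on [T] supplies the continuity that a differential must
    have. *)
Lemma is_diff_quadratic (W W' : normedModType R) (T : {linear W -> W'}) (f : W -> W')
    (q : W) (k d : R) :
  0 < d -> (forall h : W, `|T h| <= k * `|h|) ->
  (forall h : W, `|h| <= d -> `|f (q + h) - f q - T h| <= k * `|h| ^+ 2) ->
  is_diff q f T.
Proof.
move=> d0 Tk H; have Tc := lipschitz_linear_continuous Tk.
have E : f \o shift q = cst (f q) + T +o_ 0 id.
  apply/eqaddoP => e e0; have k0 : 0 < `|k| + 1 by rewrite ltr_wpDl.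
  have m0 : 0 < Num.min d (e / (`|k| + 1)) by rewrite lt_min d0 divr_gt0.
  apply/nbhs_normP; exists (Num.min d (e / (`|k| + 1))) => // h.
  rewrite /= sub0r normrN lt_min => /andP[/ltW hd].
  rewrite ltr_pdivlMr// => he.
  have -> : (f \o shift q - (cst (f q) + T)) h = f (h + q) - (f q + T h) by [].
  rewrite opprD addrA [h + q]addrC; apply: le_trans (H _ hd) _.
  rewrite expr2 mulrA ler_wpM2r//; have := ler_norm k; have := normr_ge0 h; nra.
have dT : 'd f q = T :> (W -> W') by apply: diff_unique.
apply: DiffDef => //; apply/diff_locallyP; rewrite dT; split=> //.
Qed.

Lemma is_diff_shift F h q : differentiable F (q + h) ->
  is_diff q (fun p => F (p + h)) ('d F (q + h)).
Proof.
move=> /differentiableP dF.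
have d1 : is_diff q (fun p => p + h) id.
  by apply: is_diff_eq; rewrite addr0.
exact: (is_diff_comp d1 dF).
Qed.

(** Stated for one coordinate at a time, since the intermediate [t] depends on the coordinate. *)
Lemma mean_value F q h (i : 'I_3) :
  (forall t : R, t \in `[0, 1] -> differentiable F (q + t *: h)) ->
  exists2 t : R, t \in `[0, 1] &
    F (q + h) i 0 - F q i 0 = 'd F (q + t *: h) h i 0.
Proof.
move=> dF; pose g (t : R) : R := F (q + t *: h) i 0.
have dg (t : R) : t \in `[0, 1] -> is_derive t (1 : R) g ('d F (q + t *: h) h i 0).
  move=> /dF/differentiableP hF.
  have d1 : is_diff t (fun t : R => q + t *: h) (fun s : R => s *: h).
    by apply: is_diff_eq; rewrite add0r.
  have d2 := is_diff_coord i (is_diff_comp d1 hF).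
  apply: DeriveDef; first exact: diff_derivable.
  by rewrite deriveE// diff_val /= scale1r.
have dgo (t : R) : t \in `]0, 1[ -> is_derive t (1 : R) g ('d F (q + t *: h) h i 0).
  by move=> /subset_itv_oo_cc/dg.
have cg : {within `[0, 1], continuous g}.
  apply: continuous_in_subspaceT => t /[!inE]/= /dg[dgt _].
  by apply: differentiable_continuous; apply/derivable1_diffP.
have [t t01 E] := MVT_segment ler01 dgo cg; exists t => //.
by move: E; rewrite /g scale1r scale0r addr0 subr0 mulr1.
Qed.

End Calculus.

(** * Cauchy's formula and regularity *)

Section Holomorphy.
Context {R : realType}.
Notation V := 'cV[R]_3.
Notation e3 := (basis3 R 2).
Implicit Types (F G D : V -> V) (q p v w z h c : V) (i j : 'I_3).

(* The shape [w * (matA *m v)] of the differential of a map that is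
   [phi_differentiable] with respect to [affineA k]: the values lie in the ideal
   of vectors with zero sum, which is a copy of the complex field. *)
Definition cyc_linear (f : V -> V) :=
  (forall v, f v = cyc_mul (dir v) (f e3)) /\ \sum_(i < 3) f e3 i 0 = 0.

Definition cyc_holo F q := differentiable F q /\ cyc_linear ('d F q).

Lemma cyc_mulBr a b c : cyc_mul a (b - c) = cyc_mul a b - cyc_mul a c :> V.
Proof. by rewrite -scaleN1r cyc_mulDr cyc_mulZr scaleN1r. Qed.

Lemma cyc_mulNl a b : cyc_mul (- a) b = - cyc_mul a b :> V.
Proof. by rewrite -scaleN1r cyc_mulZl scaleN1r. Qed.

Lemma cyc_mul_linear c : linear (cyc_mul c).
Proof. by move=> t v w; rewrite cyc_mulDr cyc_mulZr. Qed.

Lemma dir_mul_linear z : linear (fun h => cyc_mul (dir h) z).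
Proof. by move=> t v w; rewrite dirD dirZ cyc_mulDl cyc_mulZl. Qed.

Lemma normr_dir_mul z h : `|cyc_mul (dir h) z| <= 3 * `|z| * `|h|.
Proof.
apply: le_trans (normr_cyc_mul _ _) _; rewrite -!mulrA ler_pM2l// mulrC.
by rewrite ler_wpM2l// normr_dir.
Qed.

Lemma is_diff_cyc_mul c F dF q : is_diff q F dF ->
  is_diff q (fun p => cyc_mul c (F p)) (fun h => cyc_mul c (dF h)).
Proof.
move=> hF; pose L : {linear V -> V} := HB.pack (cyc_mul c)
  (GRing.isLinear.Build _ _ _ _ _ (cyc_mul_linear c)).
have hL : is_diff (F q) L L.
  apply: is_diff_linear; apply: (@lipschitz_linear_continuous _ _ _ _ (3 * `|c|)).
  exact: normr_cyc_mul.
exact: (is_diff_comp hF hL).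
Qed.

Lemma cyc_mul_continuous c : continuous (cyc_mul c).
Proof.
move=> q; apply: differentiable_continuous.
have d1 := is_diff_cyc_mul c (is_diff_id q).
exact: ex_diff.
Qed.

Lemma diff_affineA k q : differentiable (affineA k) q /\
  forall v, 'd (affineA k) q v = matA R *m v.
Proof.
have hA : is_diff q (mulmx (matA R) : V -> V) (mulmx (matA R)).
  apply: is_diff_linear.
  apply: (@lipschitz_linear_continuous _ _ _ _ (3 * `|matA R *m e3|)) => w.
  by have := normr_dir_mul (matA R *m e3) w; rewrite -matA_dir.
have hk : is_diff q (affineA k) (mulmx (matA R)).
  by apply: is_diff_eq; rewrite addr0.
by split=> [|v]; [exact: ex_diff|rewrite diff_val].
Qed.

(** By commutativity the factor [dir v] moves in front of [F' q * (matA *m e3)]. The sum vanishes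
    because the coordinate sum is multiplicative and is 0 on the image of [matA]. *)
Lemma phi_differentiable_holo U k F q : phi_differentiable U (affineA k) F ->
  U q -> cyc_holo F q.
Proof.
move=> [_ dF [F' F'P]] Uq; split; first exact: dF.
have E v : 'd F q v = cyc_mul (F' q) (matA R *m v).
  by rewrite (F'P q Uq) (diff_affineA k q).2.
split=> [v|]; rewrite (E e3).
  by rewrite (E v) (matA_dir v) !cyc_mulA [cyc_mul (dir v) _]cyc_mulC.
by rewrite sum_cyc_mul sum_matA mulr0.
Qed.

Lemma cyc_linearB (f g : V -> V) : cyc_linear f -> cyc_linear g ->
  cyc_linear (fun v => f v - g v).
Proof.
move=> [fv f0] [gv g0]; split=> [v|]; first by rewrite (fv v) (gv v) cyc_mulBr.
have -> : \sum_(i < 3) (f e3 - g e3) i 0 =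
    \sum_(i < 3) f e3 i 0 - \sum_(i < 3) g e3 i 0.
  by rewrite -sumrB; apply: eq_bigr => i _; rewrite mxE [X in _ + X]mxE.
by rewrite f0 g0 subrr.
Qed.

Lemma cyc_mul1 c : cyc_mul (basis3 R 0) c = c.
Proof. by have [] := cyc_mul_table R. Qed.

(** A real linear form l on a complex space is the real part of the complex linear form l(z) - i l(i
    z). Here l is the coordinate [i], and [unit_i] plays i on the values of the differential, which
    lie in the ideal. *)
Lemma holo_cauchy_riemann F q i : cyc_holo F q ->
  cauchy_riemann (fun p => F p i 0) (fun p => cyc_mul (- unit_i) (F p) i 0)
    e3 dir_i q.
Proof.
move=> [/differentiableP dF [dFv dF0]].
have du := is_diff_coord i dF.
have dv := is_diff_coord i (is_diff_cyc_mul (- unit_i) dF).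
have Eu h : 'd (fun p => F p i 0) q h = 'd F q h i 0 by rewrite diff_val.
have Ev h : 'd (fun p => cyc_mul (- unit_i) (F p) i 0) q h =
  - cyc_mul unit_i ('d F q h) i 0.
  by rewrite diff_val cyc_mulNl mxE.
have Edir : 'd F q dir_i = cyc_mul unit_i ('d F q e3) by rewrite -dir_dir_i; exact: dFv.
split; [exact: ex_diff|exact: ex_diff| |].
  by rewrite (Ev dir_i) (Eu e3) Edir unit_i_sqr// mxE opprK.
by rewrite (Ev e3) (Eu dir_i) Edir opprK.
Qed.

(** On the ideal this acts as exp(- i t), so that [r^-1] times [kernel t] is division by z - q = r
    exp(i t). *)
Definition kernel t : V := cos t *: basis3 R 0 - sin t *: unit_i.

Lemma cyc_mul_kernel t w i : cyc_mul (kernel t) w i 0 =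
  w i 0 * cos t + cyc_mul (- unit_i) w i 0 * sin t.
Proof.
rewrite /kernel -scalerN cyc_mulDl !cyc_mulZl cyc_mul1 mxE [_ i 0]mxE [X in _ + X]mxE.
by rewrite mulrC [sin t * _]mulrC.
Qed.

Definition kernel_bound : R := 3 * (1 + `|unit_i : V|).

Lemma kernel_bound_gt0 : 0 < kernel_bound.
Proof. by rewrite mulr_gt0// ltr_pwDl. Qed.

Lemma normr_kernel t w : `|cyc_mul (kernel t) w| <= kernel_bound * `|w|.
Proof.
apply: le_trans (normr_cyc_mul _ _) _; rewrite /kernel_bound ler_wpM2r// ler_pM2l//.
apply: le_trans (ler_normB _ _) _; rewrite !normrZ lerD//.
  rewrite -[leRHS]mulr1 ler_pM// ?cos_max//.
  by apply: normr_cV_le => // i; rewrite basis3E; case: eqP; rewrite ?normr1 ?normr0.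
by rewrite -[leRHS]mul1r ler_wpM2r// sin_max.
Qed.

(** * Means of difference quotients over ellipses *)

Notation circle q r t := (polar q e3 dir_i r t).

Definition kernel_slope G q r i t : R :=
  r^-1 * cyc_mul (kernel t) (G (circle q r t) - G q) i 0.

(** The right side of Cauchy's formula, set up for an arbitrary map: it is applied below to Taylor
    remainders and to derivatives whose own differentiability is still to be shown. *)
Definition circle_mean G q r i : R :=
  segint 0 (pi *+ 2) (kernel_slope G q r i) / (pi *+ 2).

Definition continuous_on_circle G q r := forall t, {for circle q r t, continuous G}.

Lemma pi2_gt0 : 0 < pi *+ 2 :> R.
Proof. by rewrite mulrn_wgt0// pi_gt0. Qed.

(* This is Cauchy's integral formula for the derivative. *)
Lemma holo_circle_mean F q r i : 0 < r ->
  (forall s t, 0 <= s <= r -> cyc_holo F (circle q s t)) ->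
  circle_mean F q r i = 'd F q e3 i 0.
Proof.
move=> r0 H; have dF : is_diff q F ('d F q).
  apply: differentiableP; rewrite -(polar0 q e3 dir_i 0).
  by apply: (H 0 0 _).1; rewrite lexx ltW.
have := @polar_mean_value _ _ (fun p => F p i 0) (fun p => cyc_mul (- unit_i) (F p) i 0)
  q e3 dir_i r r0 (fun s t st => holo_cauchy_riemann i (H s t st)).
have du := is_diff_coord i dF; rewrite diff_val /circle_mean => E.
have -> : segint 0 (pi *+ 2) (kernel_slope F q r i) = 'd F q e3 i 0 * (pi *+ 2).
  rewrite -E; apply: eq_segint => t _; rewrite /kernel_slope cyc_mul_kernel.
  rewrite /slope_re; congr (_ * (_ * _ + _ * _)); first by rewrite !mxE.
  by rewrite cyc_mulBr mxE [X in _ + X]mxE.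
by rewrite mulfK// gt_eqF// pi2_gt0.
Qed.

Lemma circle_continuous q r : continuous (fun t => circle q r t).
Proof.
move=> t; apply: differentiable_continuous.
have dc := is_diff_derive1 (is_derive_cos t).
have ds := is_diff_derive1 (is_derive_sin t).
have da := is_diff_comp (is_diffZ r dc) (is_diff_scalel _ e3).
have db := is_diff_comp (is_diffZ r ds) (is_diff_scalel _ (dir_i : V)).
have dD := is_diffD (is_diff_cst q t) (is_diffD da db).
exact: (ex_diff (df := _ )).
Qed.

Lemma kernel_slope_continuous G q r i : continuous_on_circle G q r ->
  continuous (kernel_slope G q r i).
Proof.
move=> cG t; rewrite /kernel_slope.
under eq_fun do rewrite cyc_mul_kernel.
have cGt : {for t, continuous (fun t => G (circle q r t) - G q)}.
  apply: continuousB; last exact: cst_continuous.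
  by apply: continuous_comp; [exact: circle_continuous|exact: cG].
have cc (f : V -> V) : continuous f ->
    {for t, continuous (fun t => f (G (circle q r t) - G q) i 0 : R)}.
  move=> cf; apply: (@continuous_comp _ _ _ (fun t => f (G (circle q r t) - G q))
    (fun M : V => M i 0)); last exact: coord_continuous.
  by apply: continuous_comp; [exact: cGt|exact: cf].
have h1 := continuousM (cc id (fun _ => cvg_id)) (@continuous_cos R t).
have h2 := continuousM (cc _ (@cyc_mul_continuous (- unit_i))) (@continuous_sin R t).
have h3 := continuousD h1 h2.
have h4 : {for t, continuous (fun _ : R => r^-1)} by apply: cst_continuous.
have h5 := continuousM h4 h3.
exact: h5.
Qed.

Lemma circle_mean_le G q r i M : 0 < r -> continuous_on_circle G q r ->
  (forall t, `|G (circle q r t) - G q| <= M) ->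
  `|circle_mean G q r i| <= kernel_bound * M / r.
Proof.
move=> r0 cG GM; rewrite /circle_mean normrM [`|_^-1|]gtr0_norm ?invr_gt0 ?pi2_gt0//.
rewrite ler_pdivrMr ?pi2_gt0//.
have := @segint_dist _ 0 (pi *+ 2) (kernel_bound * M / r) 0 (kernel_slope G q r i)
  (ltW pi2_gt0).
rewrite subr0 mul0r subr0; apply; first by move=> t _; exact: kernel_slope_continuous.
move=> t _; rewrite subr0 /kernel_slope normrM gtr0_norm ?invr_gt0// mulrC.
rewrite ler_pM2r ?invr_gt0// (le_trans (normr_coord _ _))//.
rewrite (le_trans (normr_kernel _ _))// ler_pM2l ?kernel_bound_gt0//.
Qed.

Lemma circle_meanB G G' q r i : continuous_on_circle G q r ->
  continuous_on_circle G' q r ->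
  circle_mean (fun p => G p - G' p) q r i = circle_mean G q r i - circle_mean G' q r i.
Proof.
move=> cG cG'; rewrite /circle_mean -mulrBl -segintB.
- congr (_ / _); apply: eq_segint => t _; rewrite /kernel_slope -mulrBr; congr (_ * _).
  have -> : G (circle q r t) - G' (circle q r t) - (G q - G' q) =
    (G (circle q r t) - G q) - (G' (circle q r t) - G' q).
    by rewrite !opprD !opprK addrACA.
  by rewrite cyc_mulBr mxE [X in _ + X]mxE.
- by move=> t _; exact: kernel_slope_continuous.
- by move=> t _; exact: kernel_slope_continuous.
Qed.

(** A constant commutes with [kernel t] and with integration. Since means are taken coordinatewise,
    the product is expanded into a combination of three of them. *)
Lemma circle_mean_cyc_mul c G q r i : continuous_on_circle G q r ->
  circle_mean (fun p => cyc_mul c (G p)) q r i =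
  cyc_mul c (\col_j circle_mean G q r j) i 0.
Proof.
move=> cG; have ck j : {in `[0, pi *+ 2], continuous (kernel_slope G q r j)}.
  by move=> t _; exact: kernel_slope_continuous.
have ckZ (k : R) j : {in `[0, pi *+ 2], continuous (fun t => k * kernel_slope G q r j t)}.
  exact: continuous_inZ.
have E t : kernel_slope (fun p => cyc_mul c (G p)) q r i t =
    c 0 0 * kernel_slope G q r i t + c 1 0 * kernel_slope G q r (i - 1) t
    + c 2 0 * kernel_slope G q r (i - 2) t.
  rewrite /kernel_slope.
  have -> : cyc_mul c (G (circle q r t)) - cyc_mul c (G q) =
      cyc_mul c (G (circle q r t) - G q).
    by rewrite cyc_mulBr.
  rewrite cyc_mulA [cyc_mul _ c]cyc_mulC -cyc_mulA cyc_mulE sum3E subr0.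
  by rewrite !mulrDr ![c _ _ * (r^-1 * _)]mulrCA.
rewrite cyc_mulE sum3E !mxE subr0 /circle_mean (eq_segint (fun t _ => E t)).
rewrite !segintD; [|exact: ckZ|exact: ckZ|exact: continuous_inD|exact: ckZ].
rewrite (segintZ (c 0 0) (ck _)) (segintZ (c 1 0) (ck _)) (segintZ (c 2 0) (ck _)).
by ring.
Qed.

(** Provides the zero sum required by [cyc_linear] for the second derivative: multiplication by the
    kernel preserves the ideal. *)
Lemma sum_circle_mean G q r : continuous_on_circle G q r ->
  (forall t, \sum_(i < 3) G (circle q r t) i 0 = 0) -> \sum_(i < 3) G q i 0 = 0 ->
  \sum_(i < 3) circle_mean G q r i = 0.
Proof.
move=> cG G0 Gq0; have ck j : {in `[0, pi *+ 2], continuous (kernel_slope G q r j)}.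
  by move=> t _; exact: kernel_slope_continuous.
rewrite sum3E /circle_mean -!mulrDl -!segintD//; last first.
  exact: continuous_inD.
rewrite (_ : segint _ _ _ = segint 0 (pi *+ 2) (cst 0)).
  by rewrite segint_cst ?mul0r ?ltW ?pi2_gt0.
apply: eq_segint => t _; rewrite /kernel_slope -!mulrDr.
rewrite -(sum3E (fun j => cyc_mul (kernel t) (G (circle q r t) - G q) j 0)) sum_cyc_mul.
have -> : \sum_(j < 3) (G (circle q r t) - G q) j 0 =
    \sum_(j < 3) G (circle q r t) j 0 - \sum_(j < 3) G q j 0.
  by rewrite -sumrB; apply: eq_bigr => j _; rewrite !mxE.
by rewrite G0 Gq0 subrr !mulr0.
Qed.

End Holomorphy.

(** * Cauchy's estimate and Lipschitz bounds *)

Section Regularity.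
Context {R : realType}.
Notation V := 'cV[R]_3.
Notation e3 := (basis3 R 2).
Notation circle q r t := (polar q e3 dir_i r t).
Implicit Types (F G D : V -> V) (q p v w z h c : V) (i j : 'I_3) (r M L : R).

(** Dividing a norm radius by this constant gives a polar radius whose ellipse stays in the ball;
    the summand 1 makes positivity immediate. *)
Definition circle_size : R := `|e3| + `|dir_i : V| + 1.

Lemma circle_size_gt0 : 0 < circle_size.
Proof. by rewrite ltr_wpDl// addr_ge0. Qed.

Lemma circle_in_ball q r s t : 0 <= s <= r / circle_size -> `|circle q s t - q| <= r.
Proof.
move=> /andP[s0]; rewrite ler_pdivlMr ?circle_size_gt0// => sr.
apply: le_trans (polar_dist _ _ _ _ s0) _; apply: le_trans sr.
by rewrite ler_wpM2l// lerDl.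
Qed.

Definition gradient_bound : R := 3 * (kernel_bound * circle_size).

Lemma gradient_bound_gt0 : 0 < gradient_bound.
Proof. by rewrite mulr_gt0// mulr_gt0// ?kernel_bound_gt0// circle_size_gt0. Qed.

(** Cauchy's estimate, from the mean formula on the largest ellipse provided by [circle_in_ball].
    Only the oscillation [F p - F q] enters, as the mean is one of difference quotients. *)
Lemma holo_gradient F q r M : 0 < r ->
  (forall p, `|p - q| <= r -> cyc_holo F p) ->
  (forall p, `|p - q| <= r -> `|F p - F q| <= M) ->
  forall v, `|'d F q v| <= gradient_bound * M / r * `|v|.
Proof.
move=> r0 holoF FM v; have cs0 := circle_size_gt0.
have qr : `|q - q| <= r by rewrite subrr normr0 ltW.
have M0 : 0 <= M by apply: le_trans (FM _ qr).
have [_ [dFv _]] := holoF _ qr; rewrite (dFv v).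
have := normr_dir_mul ('d F q e3) v => /le_trans; apply.
have rho0 : 0 < r / circle_size by rewrite divr_gt0.
have kb0 := @kernel_bound_gt0 R.
have -> : gradient_bound * M / r = 3 * (kernel_bound * M / (r / circle_size)).
  by rewrite /gradient_bound; field; rewrite !gt_eqF.
rewrite ler_wpM2r// ler_pM2l//.
apply: normr_cV_le => [|i]; first exact: divr_ge0 (mulr_ge0 (ltW kb0) M0) (ltW rho0).
rewrite -(holo_circle_mean i rho0) => [|s t srho]; last exact/holoF/circle_in_ball.
apply: circle_mean_le => // t.
  have [dF _] : cyc_holo F (circle q (r / circle_size) t).
    by apply/holoF/circle_in_ball; rewrite lexx ltW.
  exact: differentiable_continuous.
by apply/FM/circle_in_ball; rewrite lexx ltW.
Qed.

Lemma segment_in_ball q r p h t : `|p - q| <= r -> `|p + h - q| <= r ->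
  t \in `[0, 1] -> `|p + t *: h - q| <= r.
Proof.
move=> pr phr; rewrite in_itv/= => /andP[t0 t1].
have -> : p + t *: h - q = (1 - t) *: (p - q) + t *: (p + h - q).
  rewrite scalerBl scale1r [p + h - q]addrAC [t *: (p - q + h)]scalerDr.
  by rewrite addrA subrK addrAC.
apply: le_trans (ler_normD _ _) _; rewrite !normrZ !ger0_norm ?subr_ge0//.
have -> : r = (1 - t) * r + t * r by ring.
by rewrite lerD// ler_wpM2l// subr_ge0.
Qed.

Lemma lipschitz_of_gradient F q r L : 0 <= L ->
  (forall p, `|p - q| <= r -> differentiable F p) ->
  (forall p v, `|p - q| <= r -> `|'d F p v| <= L * `|v|) ->
  forall p h, `|p - q| <= r -> `|p + h - q| <= r -> `|F (p + h) - F p| <= L * `|h|.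
Proof.
move=> L0 dF FL p h pr phr; apply: normr_cV_le => [|i]; first by rewrite mulr_ge0.
have [|t t01 E] := @mean_value _ F p h i.
  by move=> t t01; apply/dF/segment_in_ball.
rewrite mxE [X in _ + X]mxE E; apply: le_trans (normr_coord _ _) _.
exact/FL/segment_in_ball.
Qed.

(** Each coordinate of the remainder is that of ['d F (p + t *: h) h - 'd F p h] for some [t] in
    [0, 1], by the mean value theorem. *)
Lemma taylor_of_lipschitz_gradient F p r L : 0 <= L ->
  (forall h, `|h| <= r -> differentiable F (p + h)) ->
  (forall h v, `|h| <= r -> `|'d F (p + h) v - 'd F p v| <= L * `|h| * `|v|) ->
  forall h, `|h| <= r -> `|F (p + h) - F p - 'd F p h| <= L * `|h| ^+ 2.
Proof.
move=> L0 dF FL h hr; apply: normr_cV_le => [|i]; first by rewrite mulr_ge0// exprn_ge0.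
have th t : t \in `[0, 1] -> `|t *: h| <= `|h|.
  rewrite in_itv/= => /andP[t0 t1]; rewrite normrZ ger0_norm//.
  by rewrite -[leRHS]mul1r ler_wpM2r.
have [|t t01 E] := @mean_value _ F p h i.
  by move=> t t01; apply/dF/(le_trans _ hr)/th.
rewrite mxE [X in X + _]mxE [X in _ + X + _]mxE E [X in _ + X]mxE.
have := normr_coord ('d F (p + t *: h) h - 'd F p h) i.
rewrite mxE [X in _ + X]mxE => /le_trans; apply.
apply: le_trans (FL _ _ (le_trans (th _ t01) hr)) _.
by rewrite expr2 mulrA ler_wpM2r// ler_wpM2l// th.
Qed.

Lemma holo_translate F q h : cyc_holo F (q + h) -> cyc_holo (fun p => F (p + h)) q /\
  'd (fun p => F (p + h)) q = 'd F (q + h) :> (V -> V).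
Proof.
move=> [dF cF]; have [dFh E] := is_diff_shift dF; split; last exact: E.
by have cFh := eq_ind_r cyc_linear cF E; split; [exact: dFh|exact: cFh].
Qed.

Lemma holoB F G q : cyc_holo F q -> cyc_holo G q ->
  cyc_holo (fun p => F p - G p) q /\
  'd (fun p => F p - G p) q = (fun v => 'd F q v - 'd G q v) :> (V -> V).
Proof.
move=> [/differentiableP dF cF] [/differentiableP dG cG].
have [dB E] := is_diffB dF dG; split; last exact: E.
by have cB := eq_ind_r cyc_linear (cyc_linearB cF cG) E; split; [exact: dB|exact: cB].
Qed.

End Regularity.

(** * Differentiability of the derivative *)

Section SecondOrder.
Context {R : realType}.
Notation V := 'cV[R]_3.
Notation e3 := (basis3 R 2).
Notation circle q r t := (polar q e3 dir_i r t).
Implicit Types (F G D : V -> V) (q p v w z h c : V) (i j : 'I_3) (r M L : R).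

(* Second differences: applying [holo_gradient] to [F (p + h) - F p] turns a
   bound on [F] into a Lipschitz bound on its differential. *)
Lemma holo_gradient_lipschitz F q r M : 0 < r ->
  (forall p, `|p - q| <= 4 * r -> cyc_holo F p) ->
  (forall p, `|p - q| <= 4 * r -> `|F p - F q| <= M) ->
  exists2 L, 0 < L & forall p h v, `|p - q| <= r -> `|h| <= r ->
    `|'d F (p + h) v - 'd F p v| <= L * `|h| * `|v|.
Proof.
move=> r0 holoF FM.
have tri p p' x y : `|p - q| <= x -> `|p' - p| <= y -> `|p' - q| <= x + y.
  move=> hp hp'; have -> : p' - q = (p - q) + (p' - p) by rewrite [RHS]addrC subrKA.
  by apply: le_trans (ler_normD _ _) _; exact: lerD.
have gb0 := @gradient_bound_gt0 R.
have M0 : 0 <= M.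
  by apply: le_trans (FM q _) => //; rewrite subrr normr0 mulr_ge0// ltW.
pose L1 := gradient_bound * (2 * M) / r.
have L10 : 0 <= L1 := divr_ge0 (mulr_ge0 (ltW gb0) (mulr_ge0 (ler0n R 2) M0)) (ltW r0).
(* Each use of Cauchy's estimate costs a margin [r]: from the ball of radius 4r to 3r here. A
   translation by [h] then takes 3r to 2r, and the second estimate 2r to r. *)
have grad1 p v : `|p - q| <= 3 * r -> `|'d F p v| <= L1 * `|v|.
  move=> pr; have p'r p' : `|p' - p| <= r -> `|p' - q| <= 4 * r.
    by move=> /(tri _ _ _ _ pr) /le_trans; apply; lra.
  apply: holo_gradient => // p' pp'; first exact/holoF/p'r.
  have -> : F p' - F p = (F p' - F q) - (F p - F q) by rewrite opprB addrA subrK.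
  have pq : `|p - q| <= 4 * r by apply: le_trans pr _; lra.
  apply: le_trans (ler_normB _ _) _; rewrite mulr_natl mulr2n.
  exact: lerD (FM _ (p'r _ pp')) (FM _ pq).
have lip p h : `|p - q| <= 3 * r -> `|p + h - q| <= 3 * r ->
    `|F (p + h) - F p| <= L1 * `|h|.
  apply: lipschitz_of_gradient => // p' p'r.
  by have [] : cyc_holo F p' by apply: holoF; apply: le_trans p'r _; lra.
pose L2 := gradient_bound * (2 * L1) / r.
have L20 : 0 <= L2 := divr_ge0 (mulr_ge0 (ltW gb0) (mulr_ge0 (ler0n R 2) L10)) (ltW r0).
exists (L2 + 1) => [|p h v pr hr]; first by rewrite ltr_wpDl.
have hp : `|p + h - p| <= r by rewrite addrC addKr.
have hol p' : `|p' - p| <= r -> cyc_holo F p' /\ cyc_holo F (p' + h).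
  move=> p'p; have p'q := tri _ _ _ _ pr p'p.
  split; apply: holoF; first by apply: le_trans p'q _; lra.
  have : `|p' + h - p'| <= r by rewrite addrC addKr.
  by move=> /(tri _ _ _ _ p'q)/le_trans; apply; lra.
have pp : `|p - p| <= r by rewrite subrr normr0 ltW.
pose G p' := F (p' + h) - F p'.
have holG p' : `|p' - p| <= r -> cyc_holo G p' /\
    'd G p' = (fun v => 'd F (p' + h) v - 'd F p' v) :> (V -> V).
  move=> /hol[h1 h2]; have [h3 E] := holo_translate h2.
  have [h4 E'] := holoB h3 h1; split; first exact: h4.
  have E2 := congr1 (fun (f : V -> V) v => f v - 'd F p' v) E.
  rewrite /= in E2; have E3 := eq_trans E' E2; exact: E3.
have -> : 'd F (p + h) v - 'd F p v = 'd G p v.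
  by have [_ E] := holG _ pp; exact: (congr1 (fun f => f v) (esym E)).
(* On the ball of radius [r] about [p], the values of [G] are at most [L1 * |h|], so its oscillation
   is at most twice that. *)
apply: (@le_trans _ _ (gradient_bound * (2 * L1 * `|h|) / r * `|v|)).
  apply: holo_gradient => // p' p'p; first by have [] := holG _ p'p.
  have p'q : `|p' - q| <= 2 * r.
    by rewrite mulr_natl mulr2n; apply: tri p'p.
  have lipG x : `|x - q| <= 2 * r -> `|F (x + h) - F x| <= L1 * `|h|.
    move=> xq; apply: lip; first by apply: le_trans xq _; lra.
    have : `|x + h - x| <= r by rewrite addrC addKr.
    by move=> /(tri _ _ _ _ xq)/le_trans; apply; lra.
  apply: le_trans (ler_normB _ _) _; rewrite -mulrA mulr_natl mulr2n.
  by apply: lerD; apply: lipG => //; apply: le_trans pr _; lra.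
have -> : gradient_bound * (2 * L1 * `|h|) / r * `|v| = L2 * `|h| * `|v|.
  by rewrite /L2; field; rewrite gt_eqF.
by rewrite ler_wpM2r// ler_wpM2r// lerDl.
Qed.

Lemma holo_second_order F q r L : 0 < r -> 0 <= L ->
  (forall p, `|p - q| <= 2 * r -> cyc_holo F p) ->
  (forall p h v, `|p - q| <= r -> `|h| <= r ->
    `|'d F (p + h) v - 'd F p v| <= L * `|h| * `|v|) ->
  cyc_holo (fun p => 'd F p e3) q.
Proof.
move=> r0 L0 holoF FL; pose D p := 'd F p e3; rewrite -/D.
have cs0 := @circle_size_gt0 R; have kb0 := @kernel_bound_gt0 R.
pose rho : R := r / circle_size.
have rho0 : 0 < rho by rewrite divr_gt0.
have circ t : `|circle q rho t - q| <= r.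
  by apply: circle_in_ball; rewrite lexx ltW.
have ball2 p : `|p - q| <= r -> `|p - q| <= 2 * r by move=> /le_trans; apply; lra.
have qq : `|q - q| <= r by rewrite subrr normr0 ltW.
have ball2h p h : `|p - q| <= r -> `|h| <= r -> `|p + h - q| <= 2 * r.
  move=> pr hr; rewrite addrAC mulr_natl mulr2n (le_trans (ler_normD _ _))//.
  exact: lerD.
have contD p : `|p - q| <= r -> {for p, continuous D}.
  move=> pr; apply/(@cvgrPdist_le _ _ _ (nbhs p)) => e e0.
  pose k := L * `|e3 : V| + 1.
  have k0 : 0 < k by rewrite ltr_wpDl// mulr_ge0.
  have m0 : 0 < Num.min r (e / k) by rewrite lt_min r0 divr_gt0.
  apply: filterS (near_dist_le p m0) => p'; rewrite le_min => /andP[h1 h2].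
  rewrite distrC.
  have pp' : p + (p' - p) = p' by rewrite addrC subrK.
  have H := FL p (p' - p) e3 pr h1; rewrite pp' in H; apply: le_trans H _.
  move: h2; rewrite ler_pdivlMr//; apply: le_trans.
  by rewrite mulrAC [leLHS]mulrC ler_wpM2l// /k lerDl.
(* [D] is a circle mean of [F], so its derivative has to be the circle mean [T0]
   of [D]; the error is the circle mean of the Taylor remainders of [F]. *)
pose T0 : V := \col_i circle_mean D q rho i.
pose T : {linear V -> V} := HB.pack (fun h => cyc_mul (dir h) T0)
  (GRing.isLinear.Build _ _ _ _ _ (dir_mul_linear T0)).
pose K := kernel_bound * (2 * L) / rho.
have K0 : 0 <= K := divr_ge0 (mulr_ge0 (ltW kb0) (mulr_ge0 (ler0n R 2) L0)) (ltW rho0).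
have dD : is_diff q D T.
  apply: (@is_diff_quadratic _ _ _ _ _ _ (K + 3 * `|T0|) r r0) => h.
    apply: le_trans (normr_dir_mul _ _) _; rewrite ler_wpM2r//.
    by rewrite lerDr.
  move=> hr; apply: (@le_trans _ _ (K * `|h| ^+ 2)); last first.
    by rewrite ler_wpM2r ?exprn_ge0// lerDl mulr_ge0.
  apply: normr_cV_le => [|i]; first by rewrite mulr_ge0// exprn_ge0.
  pose E p := F (p + h) - F p - cyc_mul (dir h) (D p).
  have contF p : `|p - q| <= 2 * r -> {for p, continuous F}.
    by move=> /holoF[dF _]; exact: differentiable_continuous.
  have c1 : continuous_on_circle (fun p => F (p + h)) q rho.
    move=> t; have [dF _] := holoF _ (ball2h _ _ (circ t) hr).
    have [dFh _] := is_diff_shift dF.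
    exact: differentiable_continuous dFh.
  have c2 : continuous_on_circle F q rho by move=> t; exact/contF/ball2/circ.
  have c3 : continuous_on_circle D q rho by move=> t; exact/contD/circ.
  have c12 : continuous_on_circle (fun p => F (p + h) - F p) q rho.
    by move=> t; apply: continuousB; [exact: c1|exact: c2].
  have c4 : continuous_on_circle (fun p => cyc_mul (dir h) (D p)) q rho.
    by move=> t; apply: continuous_comp; [exact: c3|exact: cyc_mul_continuous].
  have cE : continuous_on_circle E q rho.
    by move=> t; apply: continuousB; [exact: c12|exact: c4].
  have Emean : (D (q + h) - D q - T h) i 0 = circle_mean E q rho i.
    rewrite (circle_meanB _ c12 c4) (circle_meanB _ c1 c2) (circle_mean_cyc_mul _ _ c3).
    rewrite mxE [X in X + _]mxE [X in _ + X + _]mxE [X in _ + X]mxE; congr (_ - _ - _).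
      (* Translating the ellipse about [q + h] back to [q] turns Cauchy's formula for [F] into a
         mean of the shifted map. *)
      rewrite -(@holo_circle_mean _ F (q + h) rho i rho0); last first.
        move=> s t srho; rewrite /polar addrAC -/(polar q e3 dir_i s t).
        by apply/holoF/ball2h => //; exact: circle_in_ball.
      congr (_ / _); apply: eq_segint => t _; rewrite /kernel_slope.
      by rewrite /polar addrAC.
    rewrite (@holo_circle_mean _ F q rho i rho0) // => s t srho.
    exact/holoF/ball2/circle_in_ball.
  (* By [cyc_linear] the term subtracted in [E] is ['d F p h], so [E] is the Taylor remainder of [F]
     at [p]. *)
  have Esmall p : `|p - q| <= r -> `|E p| <= L * `|h| ^+ 2.
    move=> pr; have [_ [dFv _]] := holoF _ (ball2 _ pr).
    rewrite /E /D -(dFv h); apply: (taylor_of_lipschitz_gradient L0) hr => h' h'r.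
      by have [] := holoF _ (ball2h _ _ pr h'r).
    by move=> v; exact: FL.
  rewrite Emean; apply: (@le_trans _ _ (kernel_bound * (2 * (L * `|h| ^+ 2)) / rho)).
    apply: circle_mean_le => // t; apply: le_trans (ler_normB _ _) _.
    by rewrite mulr_natl mulr2n lerD// Esmall.
  by rewrite /K le_eqVlt; apply/orP; left; apply/eqP; field; rewrite gt_eqF.
have [diffD dDE] := dD; split; first exact: diffD.
suff : cyc_linear T by move=> cT; have cD := eq_ind_r cyc_linear cT dDE; exact: cD.
have T3 : T e3 = T0 by rewrite /T/= dir_basis2 cyc_mul1.
split=> [v|]; rewrite T3//; under eq_bigr do rewrite mxE.
apply: sum_circle_mean => [t|t|]; first exact/contD/circ.
  by have [_ []] := holoF _ (ball2 _ (circ t)).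
by have [_ []] := holoF _ (ball2 _ qq).
Qed.

Lemma holo_derivative U F : open U -> (forall q, U q -> cyc_holo F q) ->
  forall q, U q -> cyc_holo (fun p => 'd F p e3) q.
Proof.
move=> openU holoF q Uq.
have [dF _] := holoF _ Uq.
have cF : {for q, continuous F} by exact: differentiable_continuous.
have /nbhs_normP[d1 /= d10 H1] : nbhs q U by exact: open_nbhs_nbhs.
have /nbhs_normP[d2 /= d20 H2] : \forall p \near q, `|F q - F p| <= 1.
  by move/(@cvgrPdist_le _ _ _ (nbhs q)) : cF; apply.
(* A fifth, so that closed balls of radius 4r fit in the open balls given by the neighbourhoods. *)
pose r := Num.min d1 d2 / 5.
have d0 : 0 < Num.min d1 d2 by rewrite lt_min d10.
have r0 : 0 < r by rewrite divr_gt0.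
have rd : 4 * r < Num.min d1 d2 by rewrite /r; lra.
have near_q p : `|p - q| <= 4 * r -> U p /\ `|F p - F q| <= 1.
  move=> /le_lt_trans/(_ rd); rewrite lt_min distrC => /andP[p1 p2].
  by split; [exact: H1|rewrite distrC; exact: H2].
have [L L0 FL] : exists2 L, 0 < L & forall p h v, `|p - q| <= r -> `|h| <= r ->
    `|'d F (p + h) v - 'd F p v| <= L * `|h| * `|v|.
  by apply: (@holo_gradient_lipschitz F q r 1) => // p /near_q[]// /holoF.
have holo2 p : `|p - q| <= 2 * r -> cyc_holo F p.
  move=> pr; have [Up _] : U p /\ `|F p - F q| <= 1.
    by apply: near_q; apply: le_trans pr _; lra.
  exact: holoF.
exact: (holo_second_order r0 (ltW L0) holo2 FL).
Qed.

End SecondOrder.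

(** * Partial derivatives and the Laplacian *)

Section Harmonic.
Context {R : realType}.
Notation V := 'cV[R]_3.
Notation e3 := (basis3 R 2).
Implicit Types (U : set V) (F G : V -> V) (q p v c : V) (i j k : 'I_3).

(** Formulas for the partial derivatives hold only on U, so continuity is transferred along equality
    near the point. *)
Lemma near_eq_continuous (W : normedModType R) (f g : V -> W) q :
  (\near q, f q = g q) -> {for q, continuous f} -> {for q, continuous g}.
Proof.
move=> fg cf; rewrite /prop_for/continuous_at -(nbhs_singleton fg).
exact: cvg_trans (near_eq_cvg fg) cf.
Qed.

(** The constant [c] allows iteration: first partials are constants times the derivative, and the
    same rule differentiates them again. *)
Lemma derive_cyc_mul c F q v : cyc_holo F q ->
  is_derive q v (fun p => cyc_mul c (F p)) (cyc_mul (cyc_mul c (dir v)) ('d F q e3)).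
Proof.
move=> [/differentiableP dF [dFv _]]; have [dG E] := is_diff_cyc_mul c dF.
apply: DeriveDef; first exact: diff_derivable.
rewrite (deriveE v dG) -cyc_mulA -(dFv v).
exact: (congr1 (fun f => f v) E).
Qed.

Lemma derive_cyc_mul_coord c F q v j : cyc_holo F q ->
  is_derive q v (fun p => cyc_mul c (F p) j 0)
    (cyc_mul (cyc_mul c (dir v)) ('d F q e3) j 0).
Proof.
move=> [/differentiableP dF [dFv _]].
have [dG E] := is_diff_coord j (is_diff_cyc_mul c dF).
apply: DeriveDef; first exact: diff_derivable.
rewrite (deriveE v dG) -cyc_mulA -(dFv v).
exact: (congr1 (fun f => f v) E).
Qed.

Lemma cyc_mul_coord_continuous c F q j : cyc_holo F q ->
  {for q, continuous (fun p => cyc_mul c (F p) j 0)}.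
Proof.
move=> [/differentiableP dF _].
have [dG _] := is_diff_coord j (is_diff_cyc_mul c dF).
exact: differentiable_continuous dG.
Qed.

Lemma holo_harmonic U F : open U -> (forall q, U q -> cyc_holo F q) ->
  (forall j, harmonic_on U (component F j)) /\ (forall q, U q -> laplacian F q = 0).
Proof.
move=> openU holoF; pose D p := 'd F p e3; pose D2 p := 'd D p e3.
have holoD q : U q -> cyc_holo D q by exact: (holo_derivative openU holoF).
(* A second round of regularity, which yields the continuity of the second partials. *)
have holoD2 q : U q -> cyc_holo D2 q by exact: (holo_derivative openU holoD).
have nearU q (P : V -> Prop) : (forall p, U p -> P p) -> U q -> \near q, P q.
  by move=> UP Uq; apply: filterS UP _; exact: open_nbhs_nbhs.
have F1 : F = (fun p => cyc_mul (basis3 R 0) (F p)).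
  by apply/funext => p; rewrite cyc_mul1.
have comp1 j : component F j = (fun p => cyc_mul (basis3 R 0) (F p) j 0).
  by apply/funext => p; rewrite cyc_mul1.
pose d i := dir (basis3 R i).
have d1 i j q : U q -> is_derive q (basis3 R i) (component F j) (cyc_mul (d i) (D q) j 0).
  move=> Uq; rewrite comp1.
  have := derive_cyc_mul_coord (basis3 R 0) (basis3 R i) j (holoF _ Uq).
  by rewrite cyc_mul1.
have p1 i j q : U q -> partial i (component F j) q = cyc_mul (d i) (D q) j 0.
  by move=> /(d1 i j)[_].
have p1V i q : U q -> partial i F q = cyc_mul (d i) (D q).
  move=> Uq; have [_] := derive_cyc_mul (basis3 R 0) (basis3 R i) (holoF _ Uq).
  by rewrite -F1 cyc_mul1.
have d2 i k j q : U q -> is_derive q (basis3 R k) (partial i (component F j))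
    (cyc_mul (cyc_mul (d i) (d k)) (D2 q) j 0).
  move=> Uq; have near_q : \near q, cyc_mul (d i) (D q) j 0 = partial i (component F j) q.
    by apply: nearU Uq => p /p1 ->.
  have dD := derive_cyc_mul_coord (d i) (basis3 R k) j (holoD _ Uq).
  exact: near_eq_is_derive near_q dD.
have p2 i k j q : U q -> partial k (partial i (component F j)) q =
    cyc_mul (cyc_mul (d i) (d k)) (D2 q) j 0.
  by move=> /(d2 i k j)[_].
(* The coordinates of [D2 q] have zero sum, as it is the differential of the holomorphic map [D]. *)
have lap0 q : U q -> \sum_(i < 3) cyc_mul (cyc_mul (d i) (d i)) (D2 q) = 0.
  move=> Uq; have [_ [_ z0]] := holoD _ Uq.
  by under eq_bigr do rewrite -cyc_mulA; exact: sum_dir_sqr.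
split=> [j|q Uq].
  split=> [q Uq|q Uq].
    split.
    - by rewrite comp1; apply: cyc_mul_coord_continuous; exact: holoF.
    - move=> i; split; first by have [] := d1 i j _ Uq.
      have near_q : \near q, cyc_mul (d i) (D q) j 0 = partial i (component F j) q.
        by apply: nearU Uq => p /p1 ->.
      have cD := @cyc_mul_coord_continuous (d i) D q j (holoD _ Uq).
      exact: near_eq_continuous near_q cD.
    - move=> i k; split; first by have [] := d2 i k j _ Uq.
      have near_q : \near q, cyc_mul (cyc_mul (d i) (d k)) (D2 q) j 0 =
          partial k (partial i (component F j)) q.
        by apply: nearU Uq => p /p2 ->.
      have cD := @cyc_mul_coord_continuous (cyc_mul (d i) (d k)) D2 q j (holoD2 _ Uq).
      exact: near_eq_continuous near_q cD.
  rewrite /laplacian; under eq_bigr do rewrite p2//.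
  by rewrite -summxE lap0// mxE.
rewrite /laplacian -[RHS](lap0 _ Uq); apply: eq_bigr => i _.
have dD := derive_cyc_mul (d i) (basis3 R i) (holoD _ Uq).
have [_ <-] := dD; apply: near_eq_derive.
by apply: nearU Uq => p /p1V.
Qed.

End Harmonic.

Theorem theorem2p1 (R : realType) (k : 'cV[R]_3) (U : set 'cV[R]_3)
    (F : 'cV[R]_3 -> 'cV[R]_3)
    (openU : open U)
    (diffF : phi_differentiable U (affineA k) F)
    (CR1 : forall q, U q ->
       partial 0 (component F 0) q - partial 1 (component F 0) q
       - partial 0 (component F 1) q + partial 1 (component F 2) q = 0)
    (CR2 : forall q, U q ->
       - partial 0 (component F 0) q + partial 1 (component F 1) q
       + partial 0 (component F 2) q - partial 1 (component F 2) q = 0)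
    (CR3 : forall q, U q ->
       - partial 2 (component F 0) q - partial 0 (component F 1) q
       + partial 0 (component F 2) q + partial 2 (component F 2) q = 0)
    (CR4 : forall q, U q ->
       partial 0 (component F 0) q + partial 2 (component F 0) q
       - partial 2 (component F 1) q - partial 0 (component F 2) q = 0) :
  (forall i : 'I_3, harmonic_on U (component F i)) /\
  (forall q, U q -> laplacian F q = 0).
Proof.
by apply: holo_harmonic openU _ => q; exact: phi_differentiable_holo diffF.
Qed.
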